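(* Let $\psi:\mathbb{R}^2\to\mathbb{R}$ be a smooth (nonsingular) lens potential such that $T_{\mathbf y}(\mathbf x)=\tfrac12|\mathbf x-\mathbf y|^2-\psi(\mathbf x)$ is isolated for every non-caustic $\mathbf y$, and let $\boldsymbol\eta(\mathbf x)=\mathbf x-\nabla\psi(\mathbf x)$. Then: (1) If some non-caustic $\mathbf y$ has more than one lensed image, then it has at least $3$ images and there is $\mathbf x_0\in\mathbb{R}^2$ with $\det[\mathrm{Hess}\,T_{\mathbf y}](\mathbf x_0)<0$; conversely, if $\det[\mathrm{Hess}\,T_{\mathbf y}](\mathbf x_0)<0$ for some $\mathbf x_0$ and $\mathbf y_0=\boldsymbol\eta(\mathbf x_0)$ is non-caustic, then $\mathbf y_0$ has at least $3$ lensed images. (2) If there is $\mathbf x_0$ with $\kappa(\mathbf x_0)>1$ and $\mathbf y_0=\boldsymbol\eta(\mathbf x_0)$ is non-caustic, then $\mathbf y_0$ has at least $3$ lensed images.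
   Context: Lensed images of $\mathbf y$ are the critical points of $T_{\mathbf y}$ (points of $\boldsymbol\eta^{-1}(\mathbf y)$); $\det[\mathrm{Hess}\,T_{\mathbf y}]=\det[\mathrm{Jac}\,\boldsymbol\eta]$ is independent of $\mathbf y$. Caustic points are $\boldsymbol\eta(\{\det[\mathrm{Jac}\,\boldsymbol\eta]=0\})$. $\kappa=\tfrac12\nabla^2\psi$ is the surface mass density and $\Gamma^2=\tfrac14(\psi_{uu}-\psi_{vv})^2+\psi_{uv}^2$. $T_{\mathbf y}$ is isolated if $T_{\mathbf y}(\mathbf x)\to\infty$ as $|\mathbf x|\to\infty$ and the eigenvalues $1-\kappa\pm\Gamma$ of $\mathrm{Hess}\,T_{\mathbf y}(\mathbf x)$ are positive for $|\mathbf x|$ sufficiently large. *)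

(* Defs.v *)
From Stdlib Require Import Reals Lra.
Open Scope R_scope.

Definition fun2 := R -> R -> R.

Definition continuous2 (f : fun2) : Prop :=
  forall u v eps, 0 < eps -> exists delta, 0 < delta /\
    forall u' v', sqrt ((u' - u)^2 + (v' - v)^2) < delta ->
      Rabs (f u' v' - f u v) < eps.

Definition is_partial_u (f fu : fun2) : Prop :=
  forall u v, derivable_pt_lim (fun t => f t v) u (fu u v).
Definition is_partial_v (f fv : fun2) : Prop :=
  forall u v, derivable_pt_lim (fun t => f u t) v (fv u v).

Fixpoint Ck (k : nat) (f : fun2) : Prop :=
  match k with
  | O => continuous2 f
  | S k' => continuous2 f /\ exists fu fv : fun2,
      is_partial_u f fu /\ is_partial_v f fv /\ Ck k' fu /\ Ck k' fv
  end.

Definition smooth2 (f : fun2) : Prop := forall k, Ck k f.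

Definition norm2 (x1 x2 : R) : R := sqrt (x1 ^ 2 + x2 ^ 2).

Definition Tdelay (psi : fun2) (y1 y2 x1 x2 : R) : R :=
  / 2 * ((x1 - y1) ^ 2 + (x2 - y2) ^ 2) - psi x1 x2.

Definition eta1 (psiu : fun2) (x1 x2 : R) : R := x1 - psiu x1 x2.
Definition eta2 (psiv : fun2) (x1 x2 : R) : R := x2 - psiv x1 x2.

(* Lensed image of y: critical point of T_y, i.e. grad T_y(x) = 0,
   where grad T_y(x) = (x1 - y1 - psi_u(x), x2 - y2 - psi_v(x)). *)
Definition is_image (psiu psiv : fun2) (y1 y2 x1 x2 : R) : Prop :=
  x1 - y1 - psiu x1 x2 = 0 /\ x2 - y2 - psiv x1 x2 = 0.

(* det Hess T_y (x) = (1 - psi_uu)(1 - psi_vv) - psi_uv^2, which equals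
   det Jac eta (x); independent of y. *)
Definition detHessT (psiuu psiuv psivv : fun2) (x1 x2 : R) : R :=
  (1 - psiuu x1 x2) * (1 - psivv x1 x2) - (psiuv x1 x2) ^ 2.

Definition caustic (psiu psiv psiuu psiuv psivv : fun2) (y1 y2 : R) : Prop :=
  exists x1 x2, detHessT psiuu psiuv psivv x1 x2 = 0 /\
    eta1 psiu x1 x2 = y1 /\ eta2 psiv x1 x2 = y2.

Definition kappa (psiuu psivv : fun2) (x1 x2 : R) : R :=
  / 2 * (psiuu x1 x2 + psivv x1 x2).
Definition Gamma (psiuu psiuv psivv : fun2) (x1 x2 : R) : R :=
  sqrt (/ 4 * (psiuu x1 x2 - psivv x1 x2) ^ 2 + (psiuv x1 x2) ^ 2).

(* T_y is isolated: T_y -> +infinity as |x| -> infinity, and the eigenvalues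
   1 - kappa +- Gamma of Hess T_y are positive for |x| large. *)
Definition isolated (psi psiuu psiuv psivv : fun2) (y1 y2 : R) : Prop :=
  (forall M, exists Rr, forall x1 x2, Rr < norm2 x1 x2 ->
      M < Tdelay psi y1 y2 x1 x2) /\
  (exists Rr, forall x1 x2, Rr < norm2 x1 x2 ->
      0 < 1 - kappa psiuu psivv x1 x2 - Gamma psiuu psiuv psivv x1 x2 /\
      0 < 1 - kappa psiuu psivv x1 x2 + Gamma psiuu psiuv psivv x1 x2).

Definition two_images (psiu psiv : fun2) (y1 y2 : R) : Prop :=
  exists a1 a2 b1 b2, is_image psiu psiv y1 y2 a1 a2 /\
    is_image psiu psiv y1 y2 b1 b2 /\ (a1, a2) <> (b1, b2).

Definition three_images (psiu psiv : fun2) (y1 y2 : R) : Prop :=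
  exists a1 a2 b1 b2 c1 c2,
    is_image psiu psiv y1 y2 a1 a2 /\ is_image psiu psiv y1 y2 b1 b2 /\
    is_image psiu psiv y1 y2 c1 c2 /\
    (a1, a2) <> (b1, b2) /\ (a1, a2) <> (c1, c2) /\ (b1, b2) <> (c1, c2).

(* Main.v *)
From Stdlib Require Import Reals Lra Classical FunctionalExtensionality IndefiniteDescription.
From Coquelicot Require Import Coquelicot.
Require Import Defs.
Open Scope R_scope.

(* The lensed images of [y] are the zeros of [F = grad T_y], and their signs
   [sign (det Hess)] sum to [1].  What is used is a weak form: besides the global
   minimum [m] of [T_y], each zero of [F] is accompanied by another one of the
   opposite sign.

   Choose [radial e] of class C^1 with [radial e s = 1/s] for [s >= e].  The form
   [radial e (|F|^2) (P dQ - Q dP)], where [F = (P, Q)], has exterior derivative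
   [weight e (|F|^2) det(JF)] with [weight e >= 0] supported in [s <= e].  On the
   boundary of a square centered at [m] where [F(x).(x - m) > 0], the angle from
   [x - m] to [F(x)] is single-valued, so by Green's formula the integral of
   [weight e (|F|^2) det(JF)] over the square is the one for [x - m] in place of
   [F].  This applies to a large square ([T_y] is coercive and convex along rays
   near infinity) and to a small one (the Hessian is positive definite at [m]), so
   the integral over the region between the two squares vanishes.  If all zeros of
   [F] there had the same sign, then for small [e] the integrand would have
   constant sign, and it does not vanish at these zeros. *)

(** * Continuity and integration in two variables *)

(** Continuity tested on square neighbourhoods instead of Euclidean discs. *)
Definition cont2 (f : fun2) : Prop := forall u v, continuity_2d_pt f u v.

Lemma pow2_lt_pow2 x y : 0 <= x -> x < y -> x ^ 2 < y ^ 2.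
Proof. intros Hx Hy; nra. Qed.

(** The square of half-side [d / 2] lies inside the disc of radius [d]. *)
Lemma cont2_continuous2 f : continuous2 f -> cont2 f.
Proof.
intros Hf u v [eps Heps].
destruct (Hf u v eps Heps) as [d [Hd H]].
assert (Hd2 : 0 < d / 2) by lra.
exists (mkposreal _ Hd2); simpl; intros u' v' Hu Hv.
apply H.
assert (Hu2 : (u' - u) ^ 2 < (d / 2) ^ 2).
{ rewrite <- (pow2_abs (u' - u)); apply pow2_lt_pow2; [apply Rabs_pos | exact Hu]. }
assert (Hv2 : (v' - v) ^ 2 < (d / 2) ^ 2).
{ rewrite <- (pow2_abs (v' - v)); apply pow2_lt_pow2; [apply Rabs_pos | exact Hv]. }
rewrite <- (sqrt_pow2 d) by lra.
pose proof (pow2_ge_0 (u' - u)); pose proof (pow2_ge_0 (v' - v)).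
replace ((d / 2) ^ 2) with (d ^ 2 / 4) in * by field.
pose proof (pow2_ge_0 d); apply sqrt_lt_1; lra.
Qed.

Lemma cont2_const c : cont2 (fun _ _ => c).
Proof. intros u v; apply continuity_2d_pt_const. Qed.

Lemma cont2_fst : cont2 (fun u _ => u).
Proof. intros u v; apply continuity_2d_pt_id1. Qed.

Lemma cont2_snd : cont2 (fun _ v => v).
Proof. intros u v; apply continuity_2d_pt_id2. Qed.

Lemma cont2_plus f g : cont2 f -> cont2 g -> cont2 (fun u v => f u v + g u v).
Proof. intros Hf Hg u v; now apply continuity_2d_pt_plus. Qed.

Lemma cont2_minus f g : cont2 f -> cont2 g -> cont2 (fun u v => f u v - g u v).
Proof. intros Hf Hg u v; now apply continuity_2d_pt_minus. Qed.

Lemma cont2_opp f : cont2 f -> cont2 (fun u v => - f u v).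
Proof. intros Hf u v; now apply continuity_2d_pt_opp. Qed.

Lemma cont2_mult f g : cont2 f -> cont2 g -> cont2 (fun u v => f u v * g u v).
Proof. intros Hf Hg u v; now apply continuity_2d_pt_mult. Qed.

Lemma cont2_pow f n : cont2 f -> cont2 (fun u v => f u v ^ n).
Proof.
intros Hf; induction n as [|n IH]; simpl; [apply cont2_const | now apply cont2_mult].
Qed.

Lemma cont2_comp (h : R -> R) f :
  (forall s, continuity_pt h s) -> cont2 f -> cont2 (fun u v => h (f u v)).
Proof. intros Hh Hf u v; now apply continuity_1d_2d_pt_comp. Qed.

Lemma cont2_Rabs f : cont2 f -> cont2 (fun u v => Rabs (f u v)).
Proof. apply cont2_comp; exact Rcontinuity_abs. Qed.

Lemma cont2_swap f : cont2 f -> cont2 (fun u v => f v u).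
Proof.
intros Hf u v eps; destruct (Hf v u eps) as [d H].
exists d; intros; now apply H.
Qed.

Create HintDb cont2.
#[local] Hint Resolve cont2_const cont2_fst cont2_snd cont2_plus cont2_minus cont2_opp
  cont2_mult cont2_pow cont2_Rabs : cont2.

Lemma cont2_continuity_v f u v : cont2 f -> continuity_pt (f u) v.
Proof.
intros Hf; apply continuity_pt_locally; intros eps.
destruct (Hf u v eps) as [d H]; exists d; intros v' Hv'.
apply H; [rewrite Rminus_diag, Rabs_R0; apply cond_pos | exact Hv'].
Qed.

Lemma cont2_continuous_v f u v : cont2 f -> continuous (f u) v.
Proof.
intros Hf; apply continuity_pt_filterlim; now apply cont2_continuity_v.
Qed.

Lemma cont2_continuous_u f u v : cont2 f -> continuous (fun t => f t v) u.
Proof. intros Hf; apply (cont2_continuous_v (fun a b => f b a)); now apply cont2_swap. Qed.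

Lemma ex_RInt_v f u c d : cont2 f -> ex_RInt (f u) c d.
Proof.
intros Hf; apply (@ex_RInt_continuous R_CompleteNormedModule).
intros; now apply cont2_continuous_v.
Qed.

Lemma ex_RInt_u f v a b : cont2 f -> ex_RInt (fun t => f t v) a b.
Proof.
intros Hf; apply (@ex_RInt_continuous R_CompleteNormedModule).
intros; now apply cont2_continuous_u.
Qed.

Lemma RInt_minus_R (f g : R -> R) a b : ex_RInt f a b -> ex_RInt g a b ->
  RInt (fun x => f x - g x) a b = RInt f a b - RInt g a b.
Proof. exact (@RInt_minus R_CompleteNormedModule f g a b). Qed.

Lemma continuous_RInt_v f c d u :
  c <= d -> cont2 f -> continuous (fun t => RInt (f t) c d) u.
Proof.
intros Hcd Hf; apply continuity_pt_filterlim, continuity_pt_locally; intros eps.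
(* The [+ 1] keeps the denominator positive when [c = d]. Uniform continuity near the segment [{u} x
   [c, d]] then bounds the integrand. *)
assert (He : 0 < eps / (d - c + 1)).
{ apply Rdiv_lt_0_compat; [apply cond_pos | lra]. }
destruct (uniform_continuity_2d_1d' f c d u (fun x _ => Hf u x) (mkposreal _ He))
  as [del H]; simpl in H.
exists del; intros t Ht; change (Rabs (t - u) < del) in Ht.
replace (RInt (f t) c d - RInt (f u) c d)
  with (RInt (fun v => f t v - f u v) c d)
  by (apply RInt_minus_R; now apply ex_RInt_v).
apply Rle_lt_trans with ((d - c) * (eps / (d - c + 1))).
- apply abs_RInt_le_const; [exact Hcd | |].
  + now apply (@ex_RInt_minus R_NormedModule); apply ex_RInt_v.
  + intros v Hv; left; apply Rabs_def2 in Ht; apply H; try lra;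
    pose proof (cond_pos del); try lra.
    rewrite Rminus_diag, Rabs_R0; lra.
- pose proof (cond_pos eps).
  apply Rmult_lt_reg_r with (d - c + 1); [lra|].
  field_simplify; [nra|lra].
Qed.

(** As functions of the upper bound [x] of the [u]-integral, both sides vanish at [x = a] and have
    derivative [RInt (f x) c d]. *)
Lemma RInt_Fubini f a b c d : a <= b -> c <= d -> cont2 f ->
  RInt (fun u => RInt (f u) c d) a b
  = RInt (fun v => RInt (fun u => f u v) a b) c d.
Proof.
intros Hab Hcd Hf.
destruct (Req_dec a b) as [<-|Hne].
{ rewrite RInt_point; symmetry.
  rewrite (RInt_ext _ (fun _ => 0)); [rewrite RInt_const; apply Rmult_0_r|].
  intros; apply (@RInt_point R_CompleteNormedModule). }
set (D := fun x => RInt (fun u => RInt (f u) c d) a x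
                   - RInt (fun v => RInt (fun u => f u v) a x) c d).
assert (Hd : forall x v, is_derive (fun z => RInt (fun u => f u v) a z) x (f x v)).
{ intros z v; apply (is_derive_RInt (fun u => f u v) _ a).
  - apply filter_forall; intros y; apply (@RInt_correct R_CompleteNormedModule).
    now apply ex_RInt_u.
  - now apply cont2_continuous_u. }
assert (HD : forall x, a <= x <= b -> is_derive D x 0).
{ intros x Hx.
  assert (H1 : is_derive (fun x => RInt (fun u => RInt (f u) c d) a x) x (RInt (f x) c d)).
  { apply (is_derive_RInt (fun u => RInt (f u) c d) _ a).
    - apply filter_forall; intros y; apply (@RInt_correct R_CompleteNormedModule).
      apply (@ex_RInt_continuous R_CompleteNormedModule); intros; now apply continuous_RInt_v.
    - now apply continuous_RInt_v. }
  assert (H2 : is_derive (fun x => RInt (fun v => RInt (fun u => f u v) a x) c d) x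
                 (RInt (f x) c d)).
  { rewrite (RInt_ext (f x) (fun v => Derive (fun z => RInt (fun u => f u v) a z) x)).
    2: { intros v _; symmetry; apply is_derive_unique, Hd. }
    apply (is_derive_RInt_param (fun z v => RInt (fun u => f u v) a z)).
    - apply filter_forall; intros y v _; eexists; apply Hd.
    - intros v _; apply (continuity_2d_pt_ext f); [|apply Hf].
      intros; symmetry; apply is_derive_unique, Hd.
    - apply filter_forall; intros y.
      apply (@ex_RInt_continuous R_CompleteNormedModule); intros v _.
      (* Here [y] is an arbitrary real, whereas [continuous_RInt_v] wants ordered bounds; for
         [y < a] the inner integral is reversed. *)
      destruct (Rle_dec a y) as [Hay|Hay].
      + apply (continuous_RInt_v (fun v u => f u v)); [exact Hay | now apply cont2_swap].
      + apply (continuous_ext (fun v => opp (RInt (fun u => f u v) y a))).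
        { intros; apply opp_RInt_swap; now apply ex_RInt_u. }
        apply (continuous_opp (fun v => RInt (fun u => f u v) y a)).
        apply (continuous_RInt_v (fun v u => f u v)); [lra | now apply cont2_swap]. }
  replace 0 with (RInt (f x) c d - RInt (f x) c d) by ring.
  exact (is_derive_minus _ _ _ _ _ H1 H2). }
assert (E : D a = D b) by (apply (eq_is_derive D); [exact HD | lra]).
unfold D in E; rewrite (@RInt_point R_CompleteNormedModule) in E.
rewrite (RInt_ext (fun v => RInt (fun u => f u v) a a) (fun _ => 0)) in E.
2: { intros; apply (@RInt_point R_CompleteNormedModule). }
rewrite RInt_const in E; change (scal (d - c) 0) with ((d - c) * 0) in E.
change (@zero R_CompleteNormedModule) with 0 in E. lra.
Qed.

(** * Cut-off angular forms *)

(** This is [1/s] for [s >= e], continued below [e] by its tangent line at [e]. Writing it as the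
    integral of a continuous function gives the C^1 property with no gluing at [s = e]. *)
Definition radial (e s : R) : R := / e - RInt (fun x => / (Rmax e x) ^ 2) e s.

(** With [g = radial e] this is [2 (g + s g')], the factor of [dP dQ] in the exterior derivative of
    [g(P^2 + Q^2) (P dQ - Q dP)]. *)
Definition weight (e s : R) : R := 2 * (radial e s - s * / (Rmax e s) ^ 2).

Lemma Rmax_pos_l e s : 0 < e -> 0 < Rmax e s.
Proof. intros He; pose proof (Rmax_l e s); lra. Qed.

Lemma continuity_Rmax_l e s : continuity_pt (Rmax e) s.
Proof.
apply continuity_pt_locally; intros eps; exists eps; intros y Hy.
change (Rabs (y - s) < eps) in Hy; pose proof (cond_pos eps).
unfold Rmax; destruct (Rle_dec e y), (Rle_dec e s); split_Rabs; lra.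
Qed.

Lemma continuity_inv_Rmax2 e s : 0 < e -> continuity_pt (fun x => / (Rmax e x) ^ 2) s.
Proof.
intros He; apply (continuity_pt_inv (fun x => (Rmax e x) ^ 2)).
- apply (continuity_pt_comp (Rmax e) (fun x => x ^ 2)); [apply continuity_Rmax_l|].
  apply derivable_continuous_pt, derivable_pt_pow.
- apply pow_nonzero; pose proof (Rmax_pos_l e s He); lra.
Qed.

Lemma continuous_inv_Rmax2 e s : 0 < e -> continuous (fun x => / (Rmax e x) ^ 2) s.
Proof. intros He; now apply continuity_pt_filterlim, continuity_inv_Rmax2. Qed.

Lemma ex_RInt_inv_Rmax2 e a b : 0 < e -> ex_RInt (fun x => / (Rmax e x) ^ 2) a b.
Proof.
intros He; apply (@ex_RInt_continuous R_CompleteNormedModule); intros.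
now apply continuous_inv_Rmax2.
Qed.

Lemma is_derive_radial e s : 0 < e -> is_derive (radial e) s (- / (Rmax e s) ^ 2).
Proof.
intros He.
assert (H : is_derive (fun s => RInt (fun x => / (Rmax e x) ^ 2) e s) s (/ (Rmax e s) ^ 2)).
{ apply (is_derive_RInt (fun x => / (Rmax e x) ^ 2) _ e).
  - apply filter_forall; intros y; apply (@RInt_correct R_CompleteNormedModule).
    now apply ex_RInt_inv_Rmax2.
  - now apply continuous_inv_Rmax2. }
replace (- / (Rmax e s) ^ 2) with (0 - / (Rmax e s) ^ 2) by ring.
exact (is_derive_minus _ _ _ _ _ (is_derive_const (/ e) s) H).
Qed.

Lemma continuity_radial e s : 0 < e -> continuity_pt (radial e) s.
Proof.
intros He; apply derivable_continuous_pt; eexists; apply is_derive_Reals.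
now apply is_derive_radial.
Qed.

Lemma radial_outside e s : 0 < e -> e <= s -> radial e s = / s.
Proof.
intros He Hs; unfold radial.
assert (H : is_RInt (fun x => / (Rmax e x) ^ 2) e s (- / s - - / e)).
{ apply (is_RInt_derive (fun x => - / x)).
  - intros x Hx; rewrite Rmin_left, Rmax_right in Hx by lra.
    auto_derive; [lra|]; rewrite Rmax_right by lra; field; lra.
  - intros; now apply continuous_inv_Rmax2. }
rewrite (is_RInt_unique _ _ _ _ H); ring.
Qed.

Lemma radial_inside e s : 0 < e -> s <= e -> radial e s = / e + (e - s) / e ^ 2.
Proof.
intros He Hs; unfold radial.
rewrite (RInt_ext _ (fun _ => / e ^ 2)).
- rewrite RInt_const; change (scal (s - e) (/ e ^ 2)) with ((s - e) * / e ^ 2).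
  field; lra.
- intros x Hx; rewrite Rmin_right, Rmax_left in Hx by lra.
  rewrite Rmax_left; lra.
Qed.

Lemma weight_outside e s : 0 < e -> e <= s -> weight e s = 0.
Proof.
intros He Hs; unfold weight; rewrite radial_outside, Rmax_right by assumption.
field; lra.
Qed.

Lemma weight_inside e s : 0 < e -> s <= e -> weight e s = 4 * (e - s) / e ^ 2.
Proof.
intros He Hs; unfold weight; rewrite radial_inside, Rmax_left by assumption.
field; lra.
Qed.

Lemma weight_nonneg e s : 0 < e -> 0 <= weight e s.
Proof.
intros He; destruct (Rle_dec e s).
- rewrite weight_outside by assumption; lra.
- rewrite weight_inside by lra; apply Rlt_le, Rdiv_lt_0_compat; [lra|].
  apply pow_lt; lra.
Qed.

Lemma weight_0_pos e : 0 < e -> 0 < weight e 0.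
Proof.
intros He; rewrite weight_inside by lra; apply Rdiv_lt_0_compat; [lra|].
apply pow_lt; lra.
Qed.

(** Applied with [a], [b] the partial derivatives of [p], [q] in the variable other than [t], so
    that it yields the two cross derivatives needed for the curl. *)
Lemma is_derive_radial_form e (p q a b : R -> R) (t dp dq da db : R) : 0 < e ->
  is_derive p t dp -> is_derive q t dq -> is_derive a t da -> is_derive b t db ->
  is_derive (fun t => radial e (p t ^ 2 + q t ^ 2) * (p t * b t - q t * a t)) t
    (- / (Rmax e (p t ^ 2 + q t ^ 2)) ^ 2 * (2 * p t * dp + 2 * q t * dq)
       * (p t * b t - q t * a t)
     + radial e (p t ^ 2 + q t ^ 2) * (dp * b t + p t * db - dq * a t - q t * da)).
Proof.
intros He Hp Hq Ha Hb.
auto_derive.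
- repeat split; trivial; eexists; eauto using is_derive_radial.
- rewrite (is_derive_unique (fun x : R => p x) _ _ Hp), (is_derive_unique (fun x : R => q x) _ _ Hq),
    (is_derive_unique (fun x : R => a x) _ _ Ha), (is_derive_unique (fun x : R => b x) _ _ Hb).
  rewrite (is_derive_unique (fun x : R => radial e x) _ _ (is_derive_radial e _ He)).
  rewrite !Rmult_1_r; replace (p t ^ 2) with (p t * p t) by ring.
  replace (q t ^ 2) with (q t * q t) by ring.
  ring.
Qed.

(* The [atan] is the angle from [(p, q)] to [(P, Q)]. *)
Lemma is_derive_angle (P Q p q : R -> R) (t dP dQ dp dq : R) :
  is_derive P t dP -> is_derive Q t dQ -> is_derive p t dp -> is_derive q t dq ->
  0 < p t * P t + q t * Q t ->
  is_derive (fun t => atan ((p t * Q t - q t * P t) / (p t * P t + q t * Q t))) t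
    (/ (P t ^ 2 + Q t ^ 2) * (P t * dQ - Q t * dP)
     - / (p t ^ 2 + q t ^ 2) * (p t * dq - q t * dp)).
Proof.
intros HP HQ Hp Hq Hpos.
auto_derive.
- repeat split; trivial; try (eexists; eauto); lra.
- rewrite (is_derive_unique (fun x : R => P x) _ _ HP), (is_derive_unique (fun x : R => Q x) _ _ HQ),
    (is_derive_unique (fun x : R => p x) _ _ Hp), (is_derive_unique (fun x : R => q x) _ _ Hq).
  generalize (P t) (Q t) (p t) (q t) Hpos; intros x y z w H.
  (* Differentiating [atan] produces the sum of the squared cross and dot products, which by
     Lagrange's identity is the product of the two squared norms. Neither norm vanishes, the dot
     product being positive. *)
  assert (x ^ 2 + y ^ 2 <> 0).
  { intros E; assert (x = 0) by nra; assert (y = 0) by nra; subst; lra. }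
  assert (z ^ 2 + w ^ 2 <> 0).
  { intros E; assert (z = 0) by nra; assert (w = 0) by nra; subst; lra. }
  field; repeat split; try lra; try nra.
Qed.

(** * Green's formula for planar vector fields *)

(** Besides the first derivatives, the curl of the angular form involves only the mixed second
    derivatives; a single function serves for both orders of differentiation. *)
Record vfield := VField {
  vP : fun2; vQ : fun2;
  vPu : fun2; vPv : fun2; vQu : fun2; vQv : fun2;
  vPuv : fun2; vQuv : fun2;
  vPuE : is_partial_u vP vPu; vPvE : is_partial_v vP vPv;
  vQuE : is_partial_u vQ vQu; vQvE : is_partial_v vQ vQv;
  vPuvE : is_partial_v vPu vPuv; vPvuE : is_partial_u vPv vPuv;
  vQuvE : is_partial_v vQu vQuv; vQvuE : is_partial_u vQv vQuv;
  vP_cont : cont2 vP; vQ_cont : cont2 vQ;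
  vPu_cont : cont2 vPu; vPv_cont : cont2 vPv;
  vQu_cont : cont2 vQu; vQv_cont : cont2 vQv;
  vPuv_cont : cont2 vPuv; vQuv_cont : cont2 vQuv
}.

#[local] Hint Resolve vP_cont vQ_cont vPu_cont vPv_cont vQu_cont vQv_cont vPuv_cont
  vQuv_cont : cont2.

Definition sqnorm (F : vfield) : fun2 := fun u v => vP F u v ^ 2 + vQ F u v ^ 2.

Definition jacobian (F : vfield) : fun2 :=
  fun u v => vPu F u v * vQv F u v - vPv F u v * vQu F u v.

Definition dot (F G : vfield) : fun2 :=
  fun u v => vP F u v * vP G u v + vQ F u v * vQ G u v.

Definition density (e : R) (F : vfield) : fun2 :=
  fun u v => weight e (sqnorm F u v) * jacobian F u v.

(** The coefficient of [du] in [radial e (|F|^2) (P dQ - Q dP)]; [form_v] is that of [dv]. *)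
Definition form_u (e : R) (F : vfield) : fun2 :=
  fun u v => radial e (sqnorm F u v)
             * (vP F u v * vQu F u v - vQ F u v * vPu F u v).

Definition form_v (e : R) (F : vfield) : fun2 :=
  fun u v => radial e (sqnorm F u v)
             * (vP F u v * vQv F u v - vQ F u v * vPv F u v).

Definition form_u_dv (e : R) (F : vfield) : fun2 := fun u v =>
  - / (Rmax e (sqnorm F u v)) ^ 2
    * (2 * vP F u v * vPv F u v + 2 * vQ F u v * vQv F u v)
    * (vP F u v * vQu F u v - vQ F u v * vPu F u v)
  + radial e (sqnorm F u v)
    * (vPv F u v * vQu F u v + vP F u v * vQuv F u v
       - vQv F u v * vPu F u v - vQ F u v * vPuv F u v).

Definition form_v_du (e : R) (F : vfield) : fun2 := fun u v =>
  - / (Rmax e (sqnorm F u v)) ^ 2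
    * (2 * vP F u v * vPu F u v + 2 * vQ F u v * vQu F u v)
    * (vP F u v * vQv F u v - vQ F u v * vPv F u v)
  + radial e (sqnorm F u v)
    * (vPu F u v * vQv F u v + vP F u v * vQuv F u v
       - vQu F u v * vPv F u v - vQ F u v * vPuv F u v).

Lemma sqnorm_cont F : cont2 (sqnorm F).
Proof. unfold sqnorm; auto 10 with cont2. Qed.

Lemma jacobian_cont F : cont2 (jacobian F).
Proof. unfold jacobian; auto 10 with cont2. Qed.

Lemma dot_cont F G : cont2 (dot F G).
Proof. unfold dot; auto 10 with cont2. Qed.

Lemma radial_sqnorm_cont e F : 0 < e -> cont2 (fun u v => radial e (sqnorm F u v)).
Proof.
intros He; apply cont2_comp; [|apply sqnorm_cont].
intros s; now apply continuity_radial.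
Qed.

Lemma inv_Rmax2_sqnorm_cont e F :
  0 < e -> cont2 (fun u v => / (Rmax e (sqnorm F u v)) ^ 2).
Proof.
intros He; apply (cont2_comp (fun s => / (Rmax e s) ^ 2)); [|apply sqnorm_cont].
intros s; now apply continuity_inv_Rmax2.
Qed.

#[local] Hint Resolve sqnorm_cont jacobian_cont dot_cont radial_sqnorm_cont inv_Rmax2_sqnorm_cont : cont2.

Lemma form_u_cont e F : 0 < e -> cont2 (form_u e F).
Proof. intros He; unfold form_u; auto 10 with cont2. Qed.

Lemma form_v_cont e F : 0 < e -> cont2 (form_v e F).
Proof. intros He; unfold form_v; auto 10 with cont2. Qed.

Lemma form_u_dv_cont e F : 0 < e -> cont2 (form_u_dv e F).
Proof. intros He; unfold form_u_dv; auto 20 with cont2. Qed.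

Lemma form_v_du_cont e F : 0 < e -> cont2 (form_v_du e F).
Proof. intros He; unfold form_v_du; auto 20 with cont2. Qed.

(** The mixed second derivatives cancel. The [radial] terms add up to [2 * radial * jacobian], and
    those with [Rmax] to [- 2 * sqnorm * jacobian / Rmax ^ 2]. *)
Lemma density_curl e F u v : density e F u v = form_v_du e F u v - form_u_dv e F u v.
Proof.
unfold density, form_v_du, form_u_dv, weight, jacobian.
change (sqnorm F u v) with (vP F u v ^ 2 + vQ F u v ^ 2); ring.
Qed.

Lemma density_cont e F : 0 < e -> cont2 (density e F).
Proof.
intros He.
assert (H : cont2 (fun u v => form_v_du e F u v - form_u_dv e F u v)).
{ apply cont2_minus; [now apply form_v_du_cont | now apply form_u_dv_cont]. }
intros u v; apply (continuity_2d_pt_ext _ _ _ _ (fun x y => eq_sym (density_curl e F x y))).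
apply H.
Qed.

Lemma is_derive_form_u e F u v : 0 < e ->
  is_derive (form_u e F u) v (form_u_dv e F u v).
Proof.
intros He; apply is_derive_radial_form; trivial; apply is_derive_Reals.
- apply vPvE.
- apply vQvE.
- apply vPuvE.
- apply vQuvE.
Qed.

Lemma is_derive_form_v e F u v : 0 < e ->
  is_derive (fun t => form_v e F t v) u (form_v_du e F u v).
Proof.
intros He.
apply (is_derive_radial_form e (fun t => vP F t v) (fun t => vQ F t v)
  (fun t => vPv F t v) (fun t => vQv F t v)); trivial; apply is_derive_Reals.
- apply vPuE.
- apply vQuE.
- apply vPvuE.
- apply vQvuE.
Qed.

(** * Green's formula on a rectangle, and comparison of two fields on its boundary *)

Definition RInt2 (f : fun2) (a b c d : R) : R := RInt (fun u => RInt (f u) c d) a b.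

Lemma ex_RInt_RInt_v f a b c d : c <= d -> cont2 f ->
  ex_RInt (fun u => RInt (f u) c d) a b.
Proof.
intros Hcd Hf; apply (@ex_RInt_continuous R_CompleteNormedModule).
intros; now apply continuous_RInt_v.
Qed.

Lemma RInt2_minus f g a b c d : c <= d -> cont2 f -> cont2 g ->
  RInt2 (fun u v => f u v - g u v) a b c d = RInt2 f a b c d - RInt2 g a b c d.
Proof.
intros Hcd Hf Hg; unfold RInt2.
rewrite <- RInt_minus_R by now apply ex_RInt_RInt_v.
apply RInt_ext; intros u _; apply RInt_minus_R; now apply ex_RInt_v.
Qed.

(** Each half of the curl is integrated first in its own variable by the fundamental theorem of
    calculus. [RInt2] integrates in [v] first, so the [u]-derivative goes through Fubini. *)
Lemma Green_density e F a b c d : 0 < e -> a <= b -> c <= d ->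
  RInt2 (density e F) a b c d
  = RInt (form_v e F b) c d - RInt (form_v e F a) c d
    - (RInt (fun u => form_u e F u d) a b - RInt (fun u => form_u e F u c) a b).
Proof.
intros He Hab Hcd.
pose proof (form_u_cont e F He) as Cu; pose proof (form_v_cont e F He) as Cv.
pose proof (form_u_dv_cont e F He) as Cuv; pose proof (form_v_du_cont e F He) as Cvu.
replace (density e F) with (fun u v => form_v_du e F u v - form_u_dv e F u v).
2: { do 2 (apply functional_extensionality; intros); symmetry; apply density_curl. }
rewrite RInt2_minus by assumption; f_equal.
- unfold RInt2; rewrite RInt_Fubini by assumption.
  rewrite <- RInt_minus_R by now apply ex_RInt_v.
  apply RInt_ext; intros v _; apply is_RInt_unique.
  apply (is_RInt_derive (fun u => form_v e F u v)); intros.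
  + now apply is_derive_form_v.
  + now apply cont2_continuous_u.
- rewrite <- RInt_minus_R by now apply ex_RInt_u.
  apply RInt_ext; intros u _; apply is_RInt_unique.
  apply (is_RInt_derive (form_u e F u)); intros.
  + now apply is_derive_form_u.
  + now apply cont2_continuous_v.
Qed.

(** The angle from [G] to [F]: cross product over dot product. Where [dot G F] is positive this is a
    differentiable single-valued branch. *)
Definition angle (F G : vfield) : fun2 := fun u v =>
  atan ((vP G u v * vQ F u v - vQ G u v * vP F u v)
        / (vP G u v * vP F u v + vQ G u v * vQ F u v)).

(** The lower bounds put both fields where [radial e s = 1/s], so that the cut-off forms are there
    the true angular forms. *)
Definition compatible (e : R) (F G : vfield) (u v : R) : Prop :=
  e <= sqnorm F u v /\ e <= sqnorm G u v /\ 0 < dot G F u v.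

Lemma RInt_form_v_angle e F G u c d : 0 < e -> c <= d ->
  (forall v, c <= v <= d -> compatible e F G u v) ->
  RInt (form_v e F u) c d - RInt (form_v e G u) c d = angle F G u d - angle F G u c.
Proof.
intros He Hcd H.
pose proof (form_v_cont e F He) as CF; pose proof (form_v_cont e G He) as CG.
rewrite <- RInt_minus_R by now apply ex_RInt_v.
apply is_RInt_unique.
apply (is_RInt_derive (angle F G u)); intros v Hv; rewrite Rmin_left, Rmax_right in Hv by lra.
- destruct (H v Hv) as (HF & HG & Hpos).
  unfold form_v; rewrite !radial_outside by assumption.
  apply is_derive_angle; trivial; apply is_derive_Reals; (apply vPvE || apply vQvE).
- apply (cont2_continuous_v (fun u v => form_v e F u v - form_v e G u v)).
  now apply cont2_minus.
Qed.

Lemma RInt_form_u_angle e F G v a b : 0 < e -> a <= b ->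
  (forall u, a <= u <= b -> compatible e F G u v) ->
  RInt (fun u => form_u e F u v) a b - RInt (fun u => form_u e G u v) a b
  = angle F G b v - angle F G a v.
Proof.
intros He Hab H.
pose proof (form_u_cont e F He) as CF; pose proof (form_u_cont e G He) as CG.
rewrite <- RInt_minus_R by now apply ex_RInt_u.
apply is_RInt_unique.
apply (is_RInt_derive (fun u => angle F G u v)); intros u Hu; rewrite Rmin_left, Rmax_right in Hu by lra.
- destruct (H u Hu) as (HF & HG & Hpos).
  unfold form_u; rewrite !radial_outside by assumption.
  apply (is_derive_angle (fun u => vP F u v) (fun u => vQ F u v)
    (fun u => vP G u v) (fun u => vQ G u v)); trivial;
    apply is_derive_Reals; (apply vPuE || apply vQuE).
- apply (cont2_continuous_u (fun u v => form_u e F u v - form_u e G u v)).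
  now apply cont2_minus.
Qed.

(* The closed rectangle [a,b]x[c,d] minus the open rectangle ]a',b'[x]c',d'[;
   when both coincide it is the boundary. *)
Definition annulus (a b c d a' b' c' d' u v : R) : Prop :=
  (a <= u <= b /\ c <= v <= d) /\ (u <= a' \/ b' <= u \/ v <= c' \/ d' <= v).

(* By Green's formula both sides are boundary integrals; there the two angular
   forms differ by the differential of the single-valued function [angle F G]. *)
Lemma RInt2_density_eq e F G a b c d : 0 < e -> a <= b -> c <= d ->
  (forall u v, annulus a b c d a b c d u v -> compatible e F G u v) ->
  RInt2 (density e F) a b c d = RInt2 (density e G) a b c d.
Proof.
intros He Hab Hcd H.
rewrite !Green_density by assumption.
assert (Ha : forall v, c <= v <= d -> compatible e F G a v)
  by (intros; apply H; unfold annulus; lra).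
assert (Hb : forall v, c <= v <= d -> compatible e F G b v)
  by (intros; apply H; unfold annulus; lra).
assert (Hc : forall u, a <= u <= b -> compatible e F G u c)
  by (intros; apply H; unfold annulus; lra).
assert (Hd : forall u, a <= u <= b -> compatible e F G u d)
  by (intros; apply H; unfold annulus; lra).
(* Each corner value of [angle F G] occurs twice with opposite signs, so the four edges sum to
   zero. *)
apply RInt_form_v_angle in Ha, Hb; apply RInt_form_u_angle in Hc, Hd; trivial.
lra.
Qed.

(** * Change of sign between two squares *)

Lemma RInt_pos_pt (f : R -> R) a b x : a < b ->
  (forall t, continuous f t) -> (forall t, a <= t <= b -> 0 <= f t) ->
  a <= x <= b -> 0 < f x -> 0 < RInt f a b.
Proof.
intros Hab Hc Hf Hx Hpos.
assert (Hex : forall p q, ex_RInt f p q)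
  by (intros; now apply (@ex_RInt_continuous R_CompleteNormedModule)).
destruct (proj1 (continuity_pt_locally f x)
  (proj2 (continuity_pt_filterlim f x) (Hc x)) (mkposreal _ Hpos)) as [del Hdel].
simpl in Hdel; pose proof (cond_pos del) as Hd.
(* A subinterval around [x] on which [f > 0], truncated to [[a, b]] because [x] may be an
   endpoint. *)
set (lo := Rmax a (x - del / 2)); set (hi := Rmin b (x + del / 2)).
assert (Hlo : a <= lo /\ x - del / 2 <= lo) by (split; [apply Rmax_l | apply Rmax_r]).
assert (Hhi : hi <= b /\ hi <= x + del / 2) by (split; [apply Rmin_l | apply Rmin_r]).
assert (Hlohi : lo < hi)
  by (unfold lo, hi; apply Rmax_case; apply Rmin_case; lra).
rewrite <- (RInt_Chasles f a lo b), <- (RInt_Chasles f lo hi b) by auto.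
change (0 < RInt f a lo + (RInt f lo hi + RInt f hi b)).
assert (0 <= RInt f a lo) by (apply RInt_ge_0; [lra | auto | intros; apply Hf; lra]).
assert (0 <= RInt f hi b) by (apply RInt_ge_0; [lra | auto | intros; apply Hf; lra]).
assert (0 < RInt f lo hi); [|lra].
apply RInt_gt_0; auto.
intros t Ht; assert (Ht' : Rabs (t - x) < del) by (apply Rabs_def1; lra).
specialize (Hdel t Ht'); apply Rabs_def2 in Hdel; lra.
Qed.

Lemma RInt2_nonneg f a b c d : a <= b -> c <= d -> cont2 f ->
  (forall u v, a <= u <= b -> c <= v <= d -> 0 <= f u v) -> 0 <= RInt2 f a b c d.
Proof.
intros Hab Hcd Hf H; apply RInt_ge_0; [lra | now apply ex_RInt_RInt_v |].
intros u Hu; apply RInt_ge_0; [lra | now apply ex_RInt_v |].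
intros v Hv; apply H; lra.
Qed.

Lemma RInt2_pos_pt f a b c d x y : a < b -> c < d -> cont2 f ->
  (forall u v, a <= u <= b -> c <= v <= d -> 0 <= f u v) ->
  a <= x <= b -> c <= y <= d -> 0 < f x y -> 0 < RInt2 f a b c d.
Proof.
intros Hab Hcd Hf H Hx Hy Hpos; apply RInt_pos_pt with x; trivial.
- intros; apply continuous_RInt_v; [lra | trivial].
- intros t Ht; apply RInt_ge_0; [lra | now apply ex_RInt_v |].
  intros v Hv; apply H; lra.
- apply RInt_pos_pt with y; auto; intros; now apply cont2_continuous_v.
Qed.

Lemma RInt2_Chasles_u f a x b c d : c <= d -> cont2 f ->
  RInt2 f a b c d = RInt2 f a x c d + RInt2 f x b c d.
Proof.
intros Hcd Hf; symmetry; apply (@RInt_Chasles R_CompleteNormedModule);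
now apply ex_RInt_RInt_v.
Qed.

Lemma RInt2_Chasles_v f a b c y d : c <= y -> y <= d -> cont2 f ->
  RInt2 f a b c d = RInt2 f a b c y + RInt2 f a b y d.
Proof.
intros Hcy Hyd Hf; unfold RInt2.
rewrite <- (@RInt_plus R_CompleteNormedModule) by now apply ex_RInt_RInt_v.
apply RInt_ext; intros u _; symmetry; apply (@RInt_Chasles R_CompleteNormedModule);
now apply ex_RInt_v.
Qed.

(** The outer rectangle is cut into the inner one, two full-height strips at its sides, and two
    strips below and above it. The four strips contribute nonnegatively, and the one containing
    [(x, y)] positively. *)
Lemma RInt2_annulus_lt f a b c d a' b' c' d' x y :
  a < a' -> a' < b' -> b' < b -> c < c' -> c' < d' -> d' < d -> cont2 f ->
  (forall u v, annulus a b c d a' b' c' d' u v -> 0 <= f u v) ->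
  annulus a b c d a' b' c' d' x y -> 0 < f x y ->
  RInt2 f a' b' c' d' < RInt2 f a b c d.
Proof.
intros Ha Hab Hb Hc Hcd Hd Hf Hpos [Hxy Hout] Hp; unfold annulus in Hpos.
rewrite (RInt2_Chasles_u f a a' b), (RInt2_Chasles_u f a' b' b),
  (RInt2_Chasles_v f a' b' c c' d), (RInt2_Chasles_v f a' b' c' d' d) by (trivial; lra).
assert (Hin : forall p q s t, a <= p -> p <= q -> q <= b -> c <= s -> s <= t -> t <= d ->
  q <= a' \/ b' <= p \/ t <= c' \/ d' <= s -> 0 <= RInt2 f p q s t).
{ intros; apply RInt2_nonneg; trivial; intros; apply Hpos; lra. }
assert (Hin' : forall p q s t, a <= p -> p < q -> q <= b -> c <= s -> s < t -> t <= d ->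
  q <= a' \/ b' <= p \/ t <= c' \/ d' <= s -> p <= x <= q -> s <= y <= t ->
  0 < RInt2 f p q s t).
{ intros; apply RInt2_pos_pt with x y; trivial; intros; apply Hpos; lra. }
assert (0 <= RInt2 f a a' c d) by (apply Hin; lra).
assert (0 <= RInt2 f b' b c d) by (apply Hin; lra).
assert (0 <= RInt2 f a' b' c c') by (apply Hin; lra).
assert (0 <= RInt2 f a' b' d' d) by (apply Hin; lra).
destruct (Rle_dec x a').
{ assert (0 < RInt2 f a a' c d) by (apply Hin'; lra); lra. }
destruct (Rle_dec b' x).
{ assert (0 < RInt2 f b' b c d) by (apply Hin'; lra); lra. }
destruct (Rle_dec y c').
{ assert (0 < RInt2 f a' b' c c') by (apply Hin'; lra); lra. }
assert (0 < RInt2 f a' b' d' d) by (apply Hin'; lra); lra.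
Qed.

(** One minimizes in [v] on each vertical slice, choosing a minimizer [m u], and then in [u]; this
    requires the slice minimum to be continuous in [u]. *)
Lemma rectangle_min f a b c d : a <= b -> c <= d -> cont2 f ->
  exists p q, (a <= p <= b /\ c <= q <= d) /\
    forall u v, a <= u <= b -> c <= v <= d -> f p q <= f u v.
Proof.
intros Hab Hcd Hf.
assert (Hmin : forall u, { q | (forall v, c <= v <= d -> f u q <= f u v) /\ c <= q <= d }).
{ intros u; apply constructive_indefinite_description, continuity_ab_min; trivial.
  intros; now apply cont2_continuity_v. }
set (m := fun u => proj1_sig (Hmin u)).
assert (Hm : forall u, (forall v, c <= v <= d -> f u (m u) <= f u v) /\ c <= m u <= d)
  by (intros u; exact (proj2_sig (Hmin u))).
destruct (continuity_ab_min (fun u => f u (m u)) a b Hab) as [p [Hp Hpab]].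
{ intros u _; apply continuity_pt_locally; intros eps.
  destruct (uniform_continuity_2d_1d' f c d u (fun x _ => Hf u x) eps) as [del H].
  exists del; intros t Ht; change (Rabs (t - u) < del) in Ht.
  assert (H' : forall v, c <= v <= d -> Rabs (f t v - f u v) < eps).
  { intros v Hv; apply Rabs_def2 in Ht; pose proof (cond_pos del).
    apply H; try lra; rewrite Rminus_diag, Rabs_R0; lra. }
  (* Each slice minimum is compared with the value of its own slice at the minimizer of the other
     slice. *)
  destruct (Hm t) as [Ht1 Ht2], (Hm u) as [Hu1 Hu2].
  pose proof (H' _ Ht2) as K1; pose proof (H' _ Hu2) as K2.
  specialize (Ht1 _ Hu2); specialize (Hu1 _ Ht2).
  apply Rabs_def2 in K1, K2; apply Rabs_def1; lra. }
exists p, (m p); split; [split; [trivial | apply Hm]|].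
intros u v Hu Hv; apply Rle_trans with (f u (m u)); [now apply Hp | now apply Hm].
Qed.

Lemma rectangle_pos_lower f a b c d : a <= b -> c <= d -> cont2 f ->
  (forall u v, a <= u <= b -> c <= v <= d -> 0 < f u v) ->
  exists e, 0 < e /\ forall u v, a <= u <= b -> c <= v <= d -> e <= f u v.
Proof.
intros Hab Hcd Hf Hpos.
destruct (rectangle_min f a b c d Hab Hcd Hf) as (p & q & [Hp Hq] & H).
exists (f p q); auto.
Qed.

(** Four closed rectangles cover the region, and [f] has a positive minimum on each. When the inner
    and outer rectangles coincide, they degenerate to edges. *)
Lemma annulus_pos_lower f a b c d a' b' c' d' :
  a <= a' -> a' <= b' -> b' <= b -> c <= c' -> c' <= d' -> d' <= d -> cont2 f ->
  (forall u v, annulus a b c d a' b' c' d' u v -> 0 < f u v) ->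
  exists e, 0 < e /\ forall u v, annulus a b c d a' b' c' d' u v -> e <= f u v.
Proof.
intros Ha Hab Hb Hc Hcd Hd Hf Hpos; unfold annulus in *.
destruct (rectangle_pos_lower f a a' c d) as (e1 & He1 & H1); trivial; try lra.
{ intros; apply Hpos; lra. }
destruct (rectangle_pos_lower f b' b c d) as (e2 & He2 & H2); trivial; try lra.
{ intros; apply Hpos; lra. }
destruct (rectangle_pos_lower f a b c c') as (e3 & He3 & H3); trivial; try lra.
{ intros; apply Hpos; lra. }
destruct (rectangle_pos_lower f a b d' d) as (e4 & He4 & H4); trivial; try lra.
{ intros; apply Hpos; lra. }
exists (Rmin (Rmin e1 e2) (Rmin e3 e4)); split.
{ now repeat apply Rmin_glb_lt. }
pose proof (Rmin_l (Rmin e1 e2) (Rmin e3 e4)); pose proof (Rmin_r (Rmin e1 e2) (Rmin e3 e4)).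
pose proof (Rmin_l e1 e2); pose proof (Rmin_r e1 e2).
pose proof (Rmin_l e3 e4); pose proof (Rmin_r e3 e4).
intros u v [[Hu Hv] [K|[K|[K|K]]]].
- apply Rle_trans with e1; [lra | apply H1; lra].
- apply Rle_trans with e2; [lra | apply H2; lra].
- apply Rle_trans with e3; [lra | apply H3; lra].
- apply Rle_trans with e4; [lra | apply H4; lra].
Qed.

(** The reference field [x - m], whose density is carried near [m] and whose angular form is
    compared with that of [F]. *)
Definition id_field (m1 m2 : R) : vfield.
Proof.
refine (VField (fun u _ => u - m1) (fun _ v => v - m2)
  (fun _ _ => 1) (fun _ _ => 0) (fun _ _ => 0) (fun _ _ => 1)
  (fun _ _ => 0) (fun _ _ => 0) _ _ _ _ _ _ _ _ _ _ _ _ _ _ _ _);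
try (intros u v; apply is_derive_Reals; auto_derive; [trivial | ring]);
auto with cont2.
Defined.

(** Only the sign of [s] matters: it selects the sign of [jacobian F] that is assumed, for
    contradiction, to occur at all zeros in the annulus. *)
Lemma zero_sign_change F m1 m2 r L s b1 b2 : 0 < r -> r < L ->
  let inner u v := annulus (m1 - r) (m1 + r) (m2 - r) (m2 + r)
                           (m1 - r) (m1 + r) (m2 - r) (m2 + r) u v in
  let outer u v := annulus (m1 - L) (m1 + L) (m2 - L) (m2 + L)
                           (m1 - L) (m1 + L) (m2 - L) (m2 + L) u v in
  let between u v := annulus (m1 - L) (m1 + L) (m2 - L) (m2 + L)
                             (m1 - r) (m1 + r) (m2 - r) (m2 + r) u v in
  (forall u v, inner u v -> 0 < dot (id_field m1 m2) F u v) ->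
  (forall u v, outer u v -> 0 < dot (id_field m1 m2) F u v) ->
  between b1 b2 -> sqnorm F b1 b2 = 0 -> 0 < s * jacobian F b1 b2 ->
  exists c1 c2, between c1 c2 /\ sqnorm F c1 c2 = 0 /\ s * jacobian F c1 c2 <= 0.
Proof.
intros Hr HrL inner outer between Hin Hout Hb Hb0 Hbs.
apply NNPP; intros Hno.
assert (Hz : forall u v, between u v -> sqnorm F u v = 0 -> 0 < s * jacobian F u v).
{ intros u v Huv H0; destruct (Rlt_dec 0 (s * jacobian F u v)) as [|Hn]; trivial.
  exfalso; apply Hno; exists u, v; repeat split; trivial; try apply Huv; lra. }
set (G := id_field m1 m2) in *.
assert (HS : forall u v, 0 <= sqnorm F u v).
{ intros; unfold sqnorm; pose proof (pow2_ge_0 (vP F u v)); pose proof (pow2_ge_0 (vQ F u v)); lra. }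
assert (Hdot : forall u v, 0 < dot G F u v -> 0 < sqnorm F u v).
{ intros u v; unfold dot, sqnorm; intros H.
  destruct (Req_dec (vP F u v) 0) as [E1|E1]; [destruct (Req_dec (vQ F u v) 0) as [E2|E2]|].
  - rewrite E1, E2 in H; lra.
  - pose proof (pow2_gt_0 _ E2); pose proof (pow2_ge_0 (vP F u v)); lra.
  - pose proof (pow2_gt_0 _ E1); pose proof (pow2_ge_0 (vQ F u v)); lra. }
destruct (annulus_pos_lower (sqnorm F) (m1 - r) (m1 + r) (m2 - r) (m2 + r)
  (m1 - r) (m1 + r) (m2 - r) (m2 + r)) as (e1 & He1 & H1); try lra; auto with cont2.
destruct (annulus_pos_lower (sqnorm F) (m1 - L) (m1 + L) (m2 - L) (m2 + L)
  (m1 - L) (m1 + L) (m2 - L) (m2 + L)) as (e2 & He2 & H2); try lra; auto with cont2.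
(* [h] bounds [sqnorm F] below wherever [s * jacobian F <= 0] in the annulus. *)
set (h := fun u v => sqnorm F u v + (s * jacobian F u v + Rabs (s * jacobian F u v))).
destruct (annulus_pos_lower h (m1 - L) (m1 + L) (m2 - L) (m2 + L)
  (m1 - r) (m1 + r) (m2 - r) (m2 + r)) as (e3 & He3 & H3); try lra.
{ unfold h; auto 10 with cont2. }
{ intros u v Huv; unfold h; specialize (HS u v); specialize (Hz u v Huv).
  destruct (Req_dec (sqnorm F u v) 0) as [E|E].
  - specialize (Hz E); rewrite Rabs_pos_eq; lra.
  - pose proof (Rle_abs (- (s * jacobian F u v))) as K; rewrite Rabs_Ropp in K; lra. }
assert (Hr2 : 0 < r ^ 2) by now apply pow_lt.
(* [e1] and [e2] keep [F] outside the cut-off on the two boundaries, [e3] controls the sign of its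
   density in the annulus, and [r ^ 2] makes the density of [G] vanish there. *)
set (e := Rmin (Rmin e1 e2) (Rmin e3 (r ^ 2))).
assert (He : 0 < e) by (unfold e; now repeat apply Rmin_glb_lt).
assert (Hee : e <= e1 /\ e <= e2 /\ e <= e3 /\ e <= r ^ 2).
{ unfold e.
  pose proof (Rmin_l (Rmin e1 e2) (Rmin e3 (r ^ 2))); pose proof (Rmin_r (Rmin e1 e2) (Rmin e3 (r ^ 2))).
  pose proof (Rmin_l e1 e2); pose proof (Rmin_r e1 e2).
  pose proof (Rmin_l e3 (r ^ 2)); pose proof (Rmin_r e3 (r ^ 2)); lra. }
assert (HG : forall u v, between u v -> e <= sqnorm G u v).
{ intros u v [_ Huv]; apply Rle_trans with (r ^ 2); [lra|].
  unfold sqnorm; simpl vP; simpl vQ.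
  pose proof (pow2_ge_0 (u - m1)); pose proof (pow2_ge_0 (v - m2)).
  assert (r ^ 2 <= (u - m1) ^ 2 \/ r ^ 2 <= (v - m2) ^ 2); [|lra].
  destruct Huv as [K|[K|[K|K]]]; [left | left | right | right]; nra. }
assert (EQ : RInt2 (density e F) (m1 - r) (m1 + r) (m2 - r) (m2 + r)
             = RInt2 (density e G) (m1 - r) (m1 + r) (m2 - r) (m2 + r)).
{ apply RInt2_density_eq; try lra; intros u v Huv; split; [|split].
  - specialize (H1 u v Huv); lra.
  - apply HG; destruct Huv; unfold between, annulus; lra.
  - now apply Hin. }
assert (EB : RInt2 (density e F) (m1 - L) (m1 + L) (m2 - L) (m2 + L)
             = RInt2 (density e G) (m1 - L) (m1 + L) (m2 - L) (m2 + L)).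
{ apply RInt2_density_eq; try lra; intros u v Huv; split; [|split].
  - specialize (H2 u v Huv); lra.
  - apply HG; destruct Huv; unfold between, annulus; lra.
  - now apply Hout. }
pose proof (density_cont e F He) as CF; pose proof (density_cont e G He) as CG.
(* By [EQ] and [EB] the integral of [k] is zero over both squares, while on the annulus [k] reduces
   to [s * density e F]. *)
set (k := fun u v => s * (density e F u v - density e G u v)).
assert (Ck : cont2 k) by (unfold k; auto with cont2).
assert (Hk : forall a b c d, c <= d ->
  RInt2 k a b c d = s * (RInt2 (density e F) a b c d - RInt2 (density e G) a b c d)).
{ intros a b c d Hcd; rewrite <- RInt2_minus by assumption; unfold RInt2, k.
  assert (CFG : cont2 (fun u v => density e F u v - density e G u v)) by auto with cont2.
  rewrite <- (@RInt_scal R_CompleteNormedModule)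
    by (apply (ex_RInt_RInt_v (fun u v => density e F u v - density e G u v)); trivial).
  apply RInt_ext; intros u _.
  apply (@RInt_scal R_CompleteNormedModule (fun v => density e F u v - density e G u v)).
  now apply (ex_RInt_v (fun u v => density e F u v - density e G u v)). }
assert (Hkb : forall u v, between u v -> k u v = weight e (sqnorm F u v) * (s * jacobian F u v)).
{ intros u v Huv; unfold k; replace (density e G u v) with 0; [unfold density; ring|].
  unfold density; rewrite weight_outside by auto; ring. }
assert (LT : RInt2 k (m1 - r) (m1 + r) (m2 - r) (m2 + r)
             < RInt2 k (m1 - L) (m1 + L) (m2 - L) (m2 + L)).
{ apply RInt2_annulus_lt with b1 b2; try lra; trivial.
  - intros u v Huv; rewrite Hkb by exact Huv.
    (* Either the weight vanishes, or [sqnorm F < e <= h]; in the latter case a negative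
       [s * jacobian F] would give [h = sqnorm F]. *)
    destruct (Rle_dec e (sqnorm F u v)).
    + rewrite weight_outside by assumption; lra.
    + apply Rmult_le_pos; [now apply weight_nonneg|].
      specialize (H3 u v Huv); unfold h in H3.
      destruct (Rle_dec 0 (s * jacobian F u v)); trivial.
      rewrite Rabs_left in H3; lra.
  - rewrite Hkb by exact Hb; rewrite Hb0; apply Rmult_lt_0_compat; trivial.
    now apply weight_0_pos. }
rewrite !Hk, EQ, EB in LT by lra; lra.
Qed.

(** * Coercive functions with nondegenerate critical points *)

Lemma smooth2_cont2 f : smooth2 f -> cont2 f.
Proof. intros H; apply cont2_continuous2; exact (H 0%nat). Qed.

(** [Ck] only provides some partial derivative; uniqueness of derivatives identifies it with the
    given [fu]. *)
Lemma smooth2_partial_u f fu : smooth2 f -> is_partial_u f fu -> smooth2 fu.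
Proof.
intros H Hfu k; destruct (H (S k)) as [_ (gu & gv & Hgu & _ & Cu & _)].
replace fu with gu; [exact Cu|].
do 2 (apply functional_extensionality; intros).
eapply uniqueness_limite; [apply Hgu | apply Hfu].
Qed.

Lemma smooth2_partial_v f fv : smooth2 f -> is_partial_v f fv -> smooth2 fv.
Proof.
intros H Hfv k; destruct (H (S k)) as [_ (gu & gv & _ & Hgv & _ & Cv)].
replace fv with gv; [exact Cv|].
do 2 (apply functional_extensionality; intros).
eapply uniqueness_limite; [apply Hgv | apply Hfv].
Qed.

Lemma smooth2_has_partials f : smooth2 f ->
  exists fu fv, is_partial_u f fu /\ is_partial_v f fv.
Proof.
intros H; destruct (H 1%nat) as [_ (fu & fv & Hu & Hv & _)]; eauto.
Qed.

Lemma Derive_partial_u f fu u v : is_partial_u f fu -> Derive (fun t => f t v) u = fu u v.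
Proof. intros H; apply is_derive_unique, is_derive_Reals, H. Qed.

Lemma Derive_partial_v f fv u v : is_partial_v f fv -> Derive (fun t => f u t) v = fv u v.
Proof. intros H; apply is_derive_unique, is_derive_Reals, H. Qed.

Lemma ex_derive_partial_u f fu u v : is_partial_u f fu -> ex_derive (fun t => f t v) u.
Proof. intros H; eexists; apply is_derive_Reals, H. Qed.

Lemma ex_derive_partial_v f fv u v : is_partial_v f fv -> ex_derive (fun t => f u t) v.
Proof. intros H; eexists; apply is_derive_Reals, H. Qed.

Lemma mixed_partials_eq f fu fv fuv fvu :
  is_partial_u f fu -> is_partial_v f fv -> is_partial_v fu fuv -> is_partial_u fv fvu ->
  cont2 fuv -> cont2 fvu -> fuv = fvu.
Proof.
intros Hu Hv Huv Hvu Cuv Cvu.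
assert (Eu : (fun u v => Derive (fun t => f t v) u) = fu).
{ do 2 (apply functional_extensionality; intros); now apply Derive_partial_u. }
assert (Ev : (fun u v => Derive (fun t => f u t) v) = fv).
{ do 2 (apply functional_extensionality; intros); now apply Derive_partial_v. }
assert (Eu' : forall u, (fun z => Derive (fun t => f t z) u) = fu u)
  by (intros u; exact (f_equal (fun g => g u) Eu)).
assert (Ev' : forall v, (fun z => Derive (fun t => f z t) v) = (fun z => fv z v))
  by (intros v; exact (f_equal (fun g z => g z v) Ev)).
apply functional_extensionality; intros u; apply functional_extensionality; intros v.
assert (S := Schwarz f u v).
rewrite Eu', Ev' in S.
rewrite (Derive_partial_v fu fuv), (Derive_partial_u fv fvu) in S by assumption.
symmetry; apply S.
- apply locally_2d_forall; intros x y.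
  rewrite Eu', Ev'; repeat split.
  + eapply ex_derive_partial_u; eassumption.
  + eapply ex_derive_partial_v; eassumption.
  + apply (ex_derive_partial_u fv fvu); assumption.
  + apply (ex_derive_partial_v fu fuv); assumption.
- apply (continuity_2d_pt_ext fvu); [|apply Cvu].
  intros x y; rewrite Ev'; symmetry; now apply Derive_partial_u.
- apply (continuity_2d_pt_ext fuv); [|apply Cuv].
  intros x y; rewrite Eu'; symmetry; now apply Derive_partial_v.
Qed.

(** The increment is split at [(u, y)]. The horizontal part is handled by the mean value theorem and
    continuity of [fu], the vertical part by the definition of [fv u v]. *)
Lemma C1_differentiable f fu fv u v :
  is_partial_u f fu -> is_partial_v f fv -> cont2 fu ->
  differentiable_pt_lim f u v (fu u v) (fv u v).
Proof.
intros Hu Hv Cu eps.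
assert (He : 0 < eps / 2) by (pose proof (cond_pos eps); lra).
destruct (Cu u v (mkposreal _ He)) as [d1 H1]; simpl in H1.
assert (Hder : exists d2 : posreal, forall y, Rabs (y - v) < d2 ->
   Rabs (f u y - f u v - fv u v * (y - v)) <= eps / 2 * Rabs (y - v)).
{ destruct (Hv u v (eps / 2) He) as [d2 H2]; exists d2; intros y Hy.
  destruct (Req_dec y v) as [->|Hne].
  { rewrite !Rminus_diag, Rmult_0_r, Rminus_diag, Rabs_R0; lra. }
  assert (Hy0 : y - v <> 0) by lra.
  specialize (H2 (y - v) Hy0 Hy); replace (v + (y - v)) with y in H2 by ring.
  replace (f u y - f u v - fv u v * (y - v))
    with (((f u y - f u v) / (y - v) - fv u v) * (y - v)) by (field; lra).
  rewrite Rabs_mult; apply Rmult_le_compat_r; [apply Rabs_pos | lra]. }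
destruct Hder as [d2 H2].
exists (mkposreal _ (Rmin_pos _ _ (cond_pos d1) (cond_pos d2))); simpl.
intros x y Hx Hy.
pose proof (Rmin_l d1 d2); pose proof (Rmin_r d1 d2).
destruct (MVT_gen (fun t => f t y) u x (fun t => fu t y)) as [c [Hc Ec]].
{ intros; apply is_derive_Reals, Hu. }
{ intros t _; apply derivable_continuous_pt; eexists; apply Hu. }
assert (Hcu : Rabs (c - u) < d1).
{ revert Hc Hx; unfold Rmin, Rmax; repeat destruct Rle_dec; split_Rabs; lra. }
specialize (H1 c y Hcu ltac:(lra)); specialize (H2 y ltac:(lra)).
replace (f x y - f u v - (fu u v * (x - u) + fv u v * (y - v)))
  with ((fu c y - fu u v) * (x - u) + (f u y - f u v - fv u v * (y - v))) by lra.
eapply Rle_trans; [apply Rabs_triang|]; rewrite Rabs_mult.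
pose proof (Rmax_l (Rabs (x - u)) (Rabs (y - v))) as Ml.
pose proof (Rmax_r (Rabs (x - u)) (Rabs (y - v))) as Mr.
pose proof (Rabs_pos (x - u)); pose proof (Rabs_pos (y - v)).
assert (Rabs (fu c y - fu u v) * Rabs (x - u)
        <= eps / 2 * Rmax (Rabs (x - u)) (Rabs (y - v)))
  by (apply Rmult_le_compat; try apply Rabs_pos; lra).
assert (eps / 2 * Rabs (y - v) <= eps / 2 * Rmax (Rabs (x - u)) (Rabs (y - v)))
  by (apply Rmult_le_compat_l; lra).
lra.
Qed.

Lemma derivable_along_ray f fu fv m1 m2 h k s :
  is_partial_u f fu -> is_partial_v f fv -> cont2 fu ->
  derivable_pt_lim (fun s => f (m1 + s * h) (m2 + s * k)) s
    (fu (m1 + s * h) (m2 + s * k) * h + fv (m1 + s * h) (m2 + s * k) * k).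
Proof.
intros Hu Hv Cu.
apply (derivable_pt_lim_comp_2d f (fun s => m1 + s * h) (fun s => m2 + s * k)).
- now apply C1_differentiable.
- apply is_derive_Reals; auto_derive; trivial; ring.
- apply is_derive_Reals; auto_derive; trivial; ring.
Qed.

(** * Second-order behaviour along rays *)

Definition trace (F : vfield) : fun2 := fun u v => vPu F u v + vQv F u v.

Lemma trace_cont F : cont2 (trace F).
Proof. unfold trace; auto with cont2. Qed.

Definition curl_free (F : vfield) : Prop := forall u v, vPv F u v = vQu F u v.

(** If [F] is the gradient of [f], this is the derivative at [s] of [f] along the ray from [m] with
    direction [(h, k)]; [quad] then gives the second derivative. *)
Definition radial_part (F : vfield) (m1 m2 h k s : R) : R :=
  vP F (m1 + s * h) (m2 + s * k) * h + vQ F (m1 + s * h) (m2 + s * k) * k.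

Definition quad (F : vfield) (h k : R) : fun2 := fun u v =>
  (vPu F u v * h + vPv F u v * k) * h + (vQu F u v * h + vQv F u v * k) * k.

Lemma quad_cont F h k : cont2 (quad F h k).
Proof. unfold quad; auto 20 with cont2. Qed.

Lemma derivable_radial_part F m1 m2 h k s :
  derivable_pt_lim (radial_part F m1 m2 h k) s (quad F h k (m1 + s * h) (m2 + s * k)).
Proof.
unfold radial_part, quad.
apply (derivable_pt_lim_plus
  (fun s => vP F (m1 + s * h) (m2 + s * k) * h) (fun s => vQ F (m1 + s * h) (m2 + s * k) * k)).
- apply (derivable_pt_lim_scal_right (fun s => vP F (m1 + s * h) (m2 + s * k))).
  apply derivable_along_ray; [apply vPuE | apply vPvE | apply vPu_cont].
- apply (derivable_pt_lim_scal_right (fun s => vQ F (m1 + s * h) (m2 + s * k))).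
  apply derivable_along_ray; [apply vQuE | apply vQvE | apply vQu_cont].
Qed.

(** A symmetric 2 by 2 matrix with positive trace and determinant is positive definite, by
    completing the square after multiplying by its first diagonal entry. *)
Lemma quad_pos F h k u v : curl_free F -> 0 < trace F u v -> 0 < jacobian F u v ->
  h <> 0 \/ k <> 0 -> 0 < quad F h k u v.
Proof.
unfold trace, jacobian, quad; intros HF; rewrite <- (HF u v).
generalize (vPu F u v) (vPv F u v) (vQv F u v); intros a b c Ht Hj Hhk.
assert (Ha : 0 < a) by nra.
apply Rmult_lt_reg_l with a; trivial; rewrite Rmult_0_r.
replace (a * ((a * h + b * k) * h + (b * h + c * k) * k))
  with ((a * h + b * k) ^ 2 + (a * c - b * b) * k ^ 2) by ring.
destruct (Req_dec k 0) as [->|Hk].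
- destruct Hhk as [Hh|]; [|lra].
  pose proof (pow2_gt_0 h Hh); replace ((a * h + b * 0) ^ 2) with (a * a * h ^ 2) by ring.
  assert (0 < a * a) by nra; nra.
- pose proof (pow2_gt_0 k Hk); pose proof (pow2_ge_0 (a * h + b * k)); nra.
Qed.

Lemma dot_id_radial F m1 m2 u v :
  dot (id_field m1 m2) F u v = radial_part F m1 m2 (u - m1) (v - m2) 1.
Proof.
unfold dot, radial_part; simpl.
replace (m1 + 1 * (u - m1)) with u by ring; replace (m2 + 1 * (v - m2)) with v by ring; ring.
Qed.

Lemma cont2_pos_near f u v : cont2 f -> 0 < f u v ->
  exists d, 0 < d /\ forall x y, Rabs (x - u) < d -> Rabs (y - v) < d -> 0 < f x y.
Proof.
intros Cf Hf; destruct (Cf u v (mkposreal _ Hf)) as [d H]; simpl in H.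
exists d; split; [apply cond_pos|]; intros x y Hx Hy.
specialize (H x y Hx Hy); apply Rabs_def2 in H; lra.
Qed.

(** By the mean value theorem along the segment from [m], the dot product equals [quad] at an
    intermediate point, where the Jacobian matrix is still positive definite. *)
Lemma dot_pos_near_zero F m1 m2 : curl_free F ->
  vP F m1 m2 = 0 -> vQ F m1 m2 = 0 -> 0 < trace F m1 m2 -> 0 < jacobian F m1 m2 ->
  exists d, 0 < d /\ forall u v, Rabs (u - m1) < d -> Rabs (v - m2) < d ->
    u <> m1 \/ v <> m2 -> 0 < dot (id_field m1 m2) F u v.
Proof.
intros HF HP HQ Ht Hj.
destruct (cont2_pos_near _ m1 m2 (trace_cont F) Ht) as (d1 & Hd1 & H1).
destruct (cont2_pos_near _ m1 m2 (jacobian_cont F) Hj) as (d2 & Hd2 & H2).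
exists (Rmin d1 d2); split; [now apply Rmin_glb_lt|].
pose proof (Rmin_l d1 d2); pose proof (Rmin_r d1 d2).
intros u v Hu Hv Hne; rewrite dot_id_radial.
destruct (MVT_cor2 (radial_part F m1 m2 (u - m1) (v - m2)) _ 0 1 Rlt_0_1
  (fun c _ => derivable_radial_part F m1 m2 (u - m1) (v - m2) c)) as [c [Ec Hc]].
assert (E0 : radial_part F m1 m2 (u - m1) (v - m2) 0 = 0).
{ unfold radial_part; rewrite !Rmult_0_l, !Rplus_0_r, HP, HQ; ring. }
assert (Hs : forall x d, Rabs x < d -> Rabs (c * x) < d).
{ intros x d Hx; rewrite Rabs_mult, (Rabs_pos_eq c) by lra.
  pose proof (Rabs_pos x); nra. }
assert (0 < quad F (u - m1) (v - m2) (m1 + c * (u - m1)) (m2 + c * (v - m2))).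
{ apply quad_pos; trivial; [apply H1 | apply H2 | lra];
  match goal with |- Rabs (?m + ?t - ?m) < _ => replace (m + t - m) with t by ring end;
  apply Hs; lra. }
lra.
Qed.

(** * Coercive functions and conditions at a minimum *)

Definition coercive (f : fun2) : Prop :=
  forall M, exists r, forall u v, r < norm2 u v -> M < f u v.

Lemma Rabs_le_norm2_l u v : Rabs u <= norm2 u v.
Proof.
unfold norm2; rewrite <- (sqrt_pow2 (Rabs u)) by apply Rabs_pos.
rewrite pow2_abs; apply sqrt_le_1_alt; pose proof (pow2_ge_0 v); lra.
Qed.

Lemma Rabs_le_norm2_r u v : Rabs v <= norm2 u v.
Proof.
unfold norm2; rewrite <- (sqrt_pow2 (Rabs v)) by apply Rabs_pos.
rewrite pow2_abs; apply sqrt_le_1_alt; pose proof (pow2_ge_0 u); lra.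
Qed.

Lemma norm2_gt r u v : r < Rabs u \/ r < Rabs v -> r < norm2 u v.
Proof. pose proof (Rabs_le_norm2_l u v); pose proof (Rabs_le_norm2_r u v); lra. Qed.

Lemma coercive_min f : cont2 f -> coercive f ->
  exists m1 m2, forall u v, f m1 m2 <= f u v.
Proof.
intros Cf Hf; destruct (Hf (f 0 0)) as [r Hr].
(* [r] may be negative; the square of half-side [Rabs r] always contains the origin, and outside it
   [f] exceeds [f 0 0]. *)
pose proof (Rle_abs r); pose proof (Rabs_pos r).
destruct (rectangle_min f (- (Rabs r)) (Rabs r) (- (Rabs r)) (Rabs r))
  as (m1 & m2 & _ & Hm); trivial; try lra.
exists m1, m2; intros u v.
destruct (Rle_dec (Rabs u) (Rabs r)) as [Hu|Hu]; [destruct (Rle_dec (Rabs v) (Rabs r)) as [Hv|Hv]|].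
- apply Rabs_le_between in Hu, Hv; apply Hm; lra.
- apply Rle_trans with (f 0 0); [apply Hm; lra|].
  left; apply Hr, norm2_gt; lra.
- apply Rle_trans with (f 0 0); [apply Hm; lra|].
  left; apply Hr, norm2_gt; lra.
Qed.

Definition is_gradient (f : fun2) (F : vfield) : Prop :=
  is_partial_u f (vP F) /\ is_partial_v f (vQ F) /\ curl_free F.

Lemma gradient_cont f F : is_gradient f F -> cont2 f.
Proof.
intros (Hfu & Hfv & HF).
intros u v; apply differentiable_continuity_pt.
exists (vP F u v), (vQ F u v); apply C1_differentiable; trivial; apply vP_cont.
Qed.

Lemma derivable_gradient_ray f F m1 m2 h k s : is_gradient f F ->
  derivable_pt_lim (fun s => f (m1 + s * h) (m2 + s * k)) s (radial_part F m1 m2 h k s).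
Proof. intros (Hfu & Hfv & HF); apply derivable_along_ray; trivial; apply vP_cont. Qed.

Lemma min_gradient_zero f F m1 m2 : is_gradient f F ->
  (forall u v, f m1 m2 <= f u v) ->
  vP F m1 m2 = 0 /\ vQ F m1 m2 = 0.
Proof.
intros (Hfu & Hfv & HF) Hm; split.
- pose (pr := exist _ _ (Hfu m1 m2) : derivable_pt (fun t => f t m2) m1).
  change (derive_pt _ _ pr = 0).
  apply (deriv_minimum (fun t => f t m2) (m1 - 1) (m1 + 1)); intros; trivial; lra.
- pose (pr := exist _ _ (Hfv m1 m2) : derivable_pt (fun t => f m1 t) m2).
  change (derive_pt _ _ pr = 0).
  apply (deriv_minimum (fun t => f m1 t) (m2 - 1) (m2 + 1)); intros; trivial; lra.
Qed.

(** If [quad] were negative at [m], it would be so nearby, and two uses of the mean value theorem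
    would make [f] drop below its minimum along [(h, k)]. *)
Lemma min_quad_nonneg f F m1 m2 h k : is_gradient f F ->
  (forall u v, f m1 m2 <= f u v) ->
  0 <= quad F h k m1 m2.
Proof.
intros Hgrad Hm; destruct (min_gradient_zero f F m1 m2 Hgrad Hm) as [HP HQ].
apply Rnot_lt_le; intros Hq.
destruct (cont2_pos_near (fun u v => - quad F h k u v) m1 m2) as (d & Hd & H); [|lra|].
{ apply cont2_opp, quad_cont. }
(* Small enough for the whole segment up to parameter [t] to stay in the box of half-side [d]; the
   [+ 1] covers [h = k = 0]. *)
set (t := d / (Rabs h + Rabs k + 1)).
pose proof (Rabs_pos h); pose proof (Rabs_pos k).
assert (Ht : 0 < t) by (apply Rdiv_lt_0_compat; lra).
assert (Et : t * (Rabs h + Rabs k + 1) = d) by (unfold t; field; lra).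
destruct (MVT_cor2 (fun s => f (m1 + s * h) (m2 + s * k)) _ 0 t Ht
  (fun c _ => derivable_gradient_ray f F m1 m2 h k c Hgrad)) as [c [Ec Hc]].
destruct (MVT_cor2 (radial_part F m1 m2 h k) _ 0 c (proj1 Hc)
  (fun c _ => derivable_radial_part F m1 m2 h k c)) as [x [Ex Hx]].
assert (E0 : radial_part F m1 m2 h k 0 = 0).
{ unfold radial_part; rewrite !Rmult_0_l, !Rplus_0_r, HP, HQ; ring. }
assert (Hqx : 0 < - quad F h k (m1 + x * h) (m2 + x * k)).
{ apply H; match goal with |- Rabs (?m + ?t - ?m) < _ => replace (m + t - m) with t by ring end;
  rewrite Rabs_mult, (Rabs_pos_eq x) by lra; nra. }
assert (radial_part F m1 m2 h k c < 0) by nra.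
pose proof (Hm (m1 + t * h) (m2 + t * k)) as Hmt.
rewrite !Rmult_0_l, !Rplus_0_r in Ec; nra.
Qed.

Lemma min_hessian_pos f F m1 m2 : is_gradient f F -> (forall u v, f m1 m2 <= f u v) ->
  jacobian F m1 m2 <> 0 -> 0 < trace F m1 m2 /\ 0 < jacobian F m1 m2.
Proof.
intros Hgrad Hm Hj; assert (HF := proj2 (proj2 Hgrad)).
assert (Hq := fun h k => min_quad_nonneg f F m1 m2 h k Hgrad Hm); revert Hq Hj.
unfold quad, jacobian, trace; rewrite <- (HF m1 m2).
generalize (vPu F m1 m2) (vPv F m1 m2) (vQv F m1 m2); intros a b c Hq Hj.
pose proof (Hq 1 0) as H10; pose proof (Hq 0 1) as H01.
assert (Ha : 0 < a).
{ destruct (Req_dec a 0) as [->|]; [|lra].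
  assert (b <> 0) by (intros ->; lra).
  (* For [a = 0] the form at [(h, 1)] is [2 b h + c]; this [h] makes it [-1]. *)
  pose proof (Hq (- (c + 1) / (2 * b)) 1) as Hb.
  replace ((0 * (- (c + 1) / (2 * b)) + b * 1) * (- (c + 1) / (2 * b))
    + (b * (- (c + 1) / (2 * b)) + c * 1) * 1) with (- 1) in Hb by (field; trivial).
  lra. }
(* At [(-b, a)] the form equals [a] times the determinant. *)
pose proof (Hq (- b) a) as Hba.
replace ((a * - b + b * a) * - b + (b * - b + c * a) * a)
  with (a * (a * c - b * b)) in Hba by ring.
split; [lra|].
assert (0 <= a * c - b * b) by (apply Rmult_le_reg_l with a; lra); lra.
Qed.

(* Far from [m], [f] exceeds its maximum on a fixed square around [m] and is
   convex along rays, so its radial derivative is positive. *)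
Lemma dot_pos_far f F m1 m2 : is_gradient f F -> coercive f ->
  (exists r, forall u v, r < norm2 u v -> 0 < trace F u v /\ 0 < jacobian F u v) ->
  exists L0, 0 < L0 /\ forall u v L, L0 < L ->
    Rabs (u - m1) <= L -> Rabs (v - m2) <= L -> Rabs (u - m1) = L \/ Rabs (v - m2) = L ->
    0 < dot (id_field m1 m2) F u v.
Proof.
intros Hgrad Hco [r Hr]; assert (HF := proj2 (proj2 Hgrad)).
(* At sup-distance at least [K] from [m] the norm exceeds [r], so the Hessian is positive definite
   there. *)
set (K := Rabs r + Rabs m1 + Rabs m2 + 1).
pose proof (Rle_abs r); pose proof (Rabs_pos r).
pose proof (Rabs_pos m1); pose proof (Rabs_pos m2).
destruct (rectangle_min (fun u v => - f u v) (m1 - K) (m1 + K) (m2 - K) (m2 + K))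
  as (p & q & _ & Hpq); try (unfold K; lra).
{ apply cont2_opp, (gradient_cont f F Hgrad). }
destruct (Hco (f p q)) as [r1 Hr1].
pose proof (Rle_abs r1); pose proof (Rabs_pos r1).
exists (K + Rabs r1); split; [unfold K; lra|].
intros u v L HL Hu Hv HuvL; rewrite dot_id_radial.
set (h := u - m1) in *; set (k := v - m2) in *.
assert (HK : 0 < K) by (unfold K; lra).
assert (Hfar : forall s rho, 0 <= s -> rho + Rabs m1 + Rabs m2 < s * L ->
  rho < norm2 (m1 + s * h) (m2 + s * k)).
{ intros s rho Hs Hrho; apply norm2_gt.
  destruct HuvL as [E|E]; [left | right].
  - pose proof (Rabs_triang (m1 + s * h) (- m1)) as T.
    replace (m1 + s * h + - m1) with (s * h) in T by ring.
    rewrite Rabs_Ropp, Rabs_mult, (Rabs_pos_eq s), E in T by trivial; lra.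
  - pose proof (Rabs_triang (m2 + s * k) (- m2)) as T.
    replace (m2 + s * k + - m2) with (s * k) in T by ring.
    rewrite Rabs_Ropp, Rabs_mult, (Rabs_pos_eq s), E in T by trivial; lra. }
(* The parameter at which the ray from [m] to [(u, v)] leaves the square of half-side [K]. *)
set (s0 := K / L).
assert (Hs0 : 0 < s0) by (apply Rdiv_lt_0_compat; lra).
assert (Es0 : s0 * L = K) by (unfold s0; field; lra).
assert (Hs1 : s0 < 1) by nra.
assert (Hlow : f (m1 + s0 * h) (m2 + s0 * k) <= f p q).
{ apply Ropp_le_cancel.
  assert (Hc : forall x, Rabs x <= L -> - K <= s0 * x <= K).
  { intros x Hx; apply Rabs_le_between; rewrite Rabs_mult, (Rabs_pos_eq s0) by lra; nra. }
  pose proof (Hc h Hu); pose proof (Hc k Hv); apply Hpq; lra. }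
assert (Hup : f p q < f (m1 + 1 * h) (m2 + 1 * k)).
{ apply Hr1, Hfar; unfold K in HL; lra. }
(* Since [f] is larger at parameter [1] than at [s0], its radial derivative is positive at some [c]
   in between; it increases from [c] to [1] because [quad] is positive there. *)
destruct (MVT_cor2 (fun s => f (m1 + s * h) (m2 + s * k)) _ s0 1 Hs1
  (fun c _ => derivable_gradient_ray f F m1 m2 h k c Hgrad)) as [c [Ec Hc]].
destruct (MVT_cor2 (radial_part F m1 m2 h k) _ c 1 (proj2 Hc)
  (fun c _ => derivable_radial_part F m1 m2 h k c)) as [x [Ex Hx]].
assert (0 < radial_part F m1 m2 h k c) by nra.
destruct (Hr (m1 + x * h) (m2 + x * k)) as [Ht Hj].
{ apply Hfar; [lra|].
  apply Rle_lt_trans with K; [unfold K; lra|].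
  rewrite <- Es0; apply Rmult_lt_compat_r; lra. }
assert (0 < quad F h k (m1 + x * h) (m2 + x * k)).
{ apply quad_pos; trivial.
  destruct HuvL as [E|E]; [left | right]; intros E0; rewrite E0, Rabs_R0 in E; lra. }
nra.
Qed.

(** Here [m] is a global minimum of [f]. Any other zero lies between a small and a large square
    centered at [m], where [zero_sign_change] applies. *)
Lemma gradient_zeros_opposite_sign f F : is_gradient f F ->
  coercive f ->
  (exists r, forall u v, r < norm2 u v -> 0 < trace F u v /\ 0 < jacobian F u v) ->
  (forall u v, sqnorm F u v = 0 -> jacobian F u v <> 0) ->
  exists m1 m2, sqnorm F m1 m2 = 0 /\ 0 < trace F m1 m2 /\ 0 < jacobian F m1 m2 /\
    forall b1 b2, sqnorm F b1 b2 = 0 -> (b1, b2) <> (m1, m2) ->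
    exists c1 c2, sqnorm F c1 c2 = 0 /\ (c1, c2) <> (m1, m2) /\
      jacobian F b1 b2 * jacobian F c1 c2 < 0.
Proof.
intros Hgrad Hco Hinf Hnd; assert (HF := proj2 (proj2 Hgrad)).
destruct (coercive_min f (gradient_cont f F Hgrad) Hco) as (m1 & m2 & Hm).
destruct (min_gradient_zero f F m1 m2 Hgrad Hm) as [HP HQ].
assert (Hm0 : sqnorm F m1 m2 = 0) by (unfold sqnorm; rewrite HP, HQ; ring).
destruct (min_hessian_pos f F m1 m2 Hgrad Hm (Hnd _ _ Hm0)) as [Ht Hj].
exists m1, m2; repeat split; trivial.
intros b1 b2 Hb Hbm.
destruct (dot_pos_near_zero F m1 m2 HF HP HQ Ht Hj) as (d & Hd & Hnear).
destruct (dot_pos_far f F m1 m2 Hgrad Hco Hinf) as (L0 & HL0 & Hfar).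
set (D := Rmax (Rabs (b1 - m1)) (Rabs (b2 - m2))).
assert (HDl : Rabs (b1 - m1) <= D) by apply Rmax_l.
assert (HDr : Rabs (b2 - m2) <= D) by apply Rmax_r.
assert (HD : 0 < D).
{ destruct (Req_dec b1 m1) as [->|E]; [destruct (Req_dec b2 m2) as [->|E]|].
  - now contradiction Hbm.
  - assert (0 < Rabs (b2 - m2)) by (apply Rabs_pos_lt; lra); lra.
  - assert (0 < Rabs (b1 - m1)) by (apply Rabs_pos_lt; lra); lra. }
(* [D] is the sup-distance from [m] to [b]. Thus [b] lies between the squares, the inner one is
   within reach of [Hnear], and the outer one is beyond [L0]. *)
set (r := Rmin D d / 2); set (L := L0 + D + 1).
assert (0 < Rmin D d) by now apply Rmin_glb_lt.
pose proof (Rmin_l D d); pose proof (Rmin_r D d).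
assert (Hr : 0 < r /\ r < D /\ r < d) by (unfold r; lra).
assert (Hframe : forall l u v, 0 < l ->
  annulus (m1 - l) (m1 + l) (m2 - l) (m2 + l) (m1 - l) (m1 + l) (m2 - l) (m2 + l) u v ->
  Rabs (u - m1) <= l /\ Rabs (v - m2) <= l /\ (Rabs (u - m1) = l \/ Rabs (v - m2) = l)).
{ intros l u v Hl [[Hu Hv] E]; repeat split; try (apply Rabs_le; lra).
  unfold Rabs; repeat destruct Rcase_abs; lra. }
(* Taking [s = jacobian F b1 b2] makes [s * jacobian F b1 b2] a nonzero square; nondegeneracy at [c]
   later turns the weak inequality into a strict one. *)
destruct (zero_sign_change F m1 m2 r L (jacobian F b1 b2) b1 b2)
  as (c1 & c2 & Hc & Hc0 & Hcb); unfold L in *; trivial; try lra.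
- intros u v Huv; apply Hframe in Huv; [|lra].
  apply Hnear; try lra.
  destruct Huv as (_ & _ & [E|E]); [left | right]; intros ->;
  rewrite Rminus_diag, Rabs_R0 in E; lra.
- intros u v Huv; apply Hframe in Huv; [|lra].
  apply Hfar with (L0 + D + 1); lra.
- apply Rabs_le_between in HDl, HDr; split; [lra|].
  assert (HD' : Rabs (b1 - m1) = D \/ Rabs (b2 - m2) = D)
    by (unfold D, Rmax; destruct Rle_dec; auto).
  destruct Hr as (_ & Hr & _); revert HD'; unfold Rabs; repeat destruct Rcase_abs; lra.
- pose proof (Hnd _ _ Hb); apply Rsqr_pos_lt; trivial.
- exists c1, c2; repeat split; trivial.
  + intros E; injection E; intros -> ->; destruct Hc; lra.
  + pose proof (Hnd _ _ Hb); pose proof (Hnd _ _ Hc0).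
    assert (jacobian F b1 b2 * jacobian F c1 c2 <> 0) by now apply Rmult_integral_contrapositive_currified.
    lra.
Qed.

(** * Lensed images *)

(** The field is the gradient of [T_y]; its mixed second derivatives are third derivatives of [psi],
    supplied by smoothness. *)
Lemma delay_gradient psi psiu psiv psiuu psiuv psivv y1 y2 :
  smooth2 psi -> is_partial_u psi psiu -> is_partial_v psi psiv ->
  is_partial_u psiu psiuu -> is_partial_v psiu psiuv ->
  is_partial_u psiv psiuv -> is_partial_v psiv psivv ->
  exists F, is_gradient (Tdelay psi y1 y2) F /\
    (forall u v, sqnorm F u v = 0 <-> is_image psiu psiv y1 y2 u v) /\
    (forall u v, jacobian F u v = detHessT psiuu psiuv psivv u v) /\
    (forall u v, trace F u v = 2 * (1 - kappa psiuu psivv u v)).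
Proof.
intros S0 Hu Hv Huu Huv Hvu Hvv.
assert (Su := smooth2_partial_u _ _ S0 Hu); assert (Sv := smooth2_partial_v _ _ S0 Hv).
assert (Suu := smooth2_partial_u _ _ Su Huu); assert (Suv := smooth2_partial_v _ _ Su Huv).
assert (Svv := smooth2_partial_v _ _ Sv Hvv).
destruct (smooth2_has_partials _ Suu) as (_ & psiuuv & _ & Huuv).
destruct (smooth2_has_partials _ Suv) as (psiuvu & psiuvv & Huvu & Huvv).
destruct (smooth2_has_partials _ Svv) as (psivvu & _ & Hvvu & _).
assert (Suuv := smooth2_partial_v _ _ Suu Huuv); assert (Suvu := smooth2_partial_u _ _ Suv Huvu).
assert (Suvv := smooth2_partial_v _ _ Suv Huvv); assert (Svvu := smooth2_partial_u _ _ Svv Hvvu).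
apply smooth2_cont2 in S0, Su, Sv, Suu, Suv, Svv, Suuv, Suvu, Suvv, Svvu.
(* Schwarz's theorem, applied to [psiu] and [psiv], provides the common mixed derivatives that a
   [vfield] stores. *)
assert (E1 : psiuuv = psiuvu) by (apply (mixed_partials_eq psiu psiuu psiuv); trivial).
assert (E2 : psiuvv = psivvu) by (apply (mixed_partials_eq psiv psiuv psivv); trivial).
rewrite <- E1 in Huvu; rewrite <- E2 in Hvvu.
assert (Hsub : forall (g h : R -> R) t a b, derivable_pt_lim g t a -> derivable_pt_lim h t b ->
  forall c, c = a - b -> derivable_pt_lim (fun t => g t - h t) t c).
{ intros g h t a b Hg Hh c ->; now apply derivable_pt_lim_minus. }
assert (Hid : forall y t, derivable_pt_lim (fun t => t - y) t 1).
{ intros; apply is_derive_Reals; auto_derive; trivial; ring. }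
assert (Hopp : forall (h : R -> R) t b, derivable_pt_lim h t b ->
  derivable_pt_lim (fun t => - h t) t (- b)).
{ intros; now apply derivable_pt_lim_opp. }
assert (Hc : forall c t : R, derivable_pt_lim (fun _ => c) t 0).
{ intros; apply derivable_pt_lim_const. }
unshelve eexists (VField (fun u v => u - y1 - psiu u v) (fun u v => v - y2 - psiv u v)
  (fun u v => 1 - psiuu u v) (fun u v => - psiuv u v)
  (fun u v => - psiuv u v) (fun u v => 1 - psivv u v)
  (fun u v => - psiuuv u v) (fun u v => - psiuvv u v) _ _ _ _ _ _ _ _ _ _ _ _ _ _ _ _);
  auto 10 with cont2.
- intros u v; apply (Hsub (fun t => t - y1) (fun t => psiu t v) _ _ _ (Hid _ _) (Huu u v)); ring.
- intros u v; apply (Hsub (fun _ => u - y1) (fun t => psiu u t) _ _ _ (Hc _ _) (Huv u v)); ring.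
- intros u v; apply (Hsub (fun _ => v - y2) (fun t => psiv t v) _ _ _ (Hc _ _) (Hvu u v)); ring.
- intros u v; apply (Hsub (fun t => t - y2) (fun t => psiv u t) _ _ _ (Hid _ _) (Hvv u v)); ring.
- intros u v; apply (Hsub (fun _ => 1) (fun t => psiuu u t) _ _ _ (Hc _ _) (Huuv u v)); ring.
- intros u v; apply (Hopp (fun t => psiuv t v)), Huvu.
- intros u v; apply (Hopp (fun t => psiuv u t)), Huvv.
- intros u v; apply (Hsub (fun _ => 1) (fun t => psivv t v) _ _ _ (Hc _ _) (Hvvu u v)); ring.
- split; [|split; [|split]].
  + split; [|split]; simpl.
    * intros u v; apply (Hsub (fun t => / 2 * ((t - y1) ^ 2 + (v - y2) ^ 2)) (fun t => psi t v)
        _ (u - y1) _) with (2 := Hu u v); [|ring].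
      apply is_derive_Reals; auto_derive; trivial; field.
    * intros u v; apply (Hsub (fun t => / 2 * ((u - y1) ^ 2 + (t - y2) ^ 2)) (fun t => psi u t)
        _ (v - y2) _) with (2 := Hv u v); [|ring].
      apply is_derive_Reals; auto_derive; trivial; field.
    * intros u v; reflexivity.
  + intros u v; unfold sqnorm, is_image; simpl vP; simpl vQ; split.
    * intros H; apply Rplus_sqr_eq_0; rewrite <- H; unfold Rsqr; ring.
    * intros [-> ->]; ring.
  + intros u v; unfold jacobian, detHessT; simpl; ring.
  + intros u v; unfold trace, kappa; simpl; field.
Qed.

(** Trace and determinant are the sum and the product of the eigenvalues [1 - kappa +- Gamma]. *)
Lemma hessian_pos_of_eigenvalues psiuu psiuv psivv u v :
  0 < 1 - kappa psiuu psivv u v - Gamma psiuu psiuv psivv u v ->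
  0 < 1 - kappa psiuu psivv u v + Gamma psiuu psiuv psivv u v ->
  0 < 2 * (1 - kappa psiuu psivv u v) /\ 0 < detHessT psiuu psiuv psivv u v.
Proof.
intros H1 H2; split; [lra|].
pose proof (Rmult_lt_0_compat _ _ H1 H2) as H.
assert (HG : Gamma psiuu psiuv psivv u v ^ 2
             = / 4 * (psiuu u v - psivv u v) ^ 2 + psiuv u v ^ 2).
{ apply pow2_sqrt; pose proof (pow2_ge_0 (psiuu u v - psivv u v));
  pose proof (pow2_ge_0 (psiuv u v)); lra. }
replace (detHessT psiuu psiuv psivv u v) with
  ((1 - kappa psiuu psivv u v) ^ 2 - Gamma psiuu psiuv psivv u v ^ 2).
{ replace ((1 - kappa psiuu psivv u v) ^ 2 - Gamma psiuu psiuv psivv u v ^ 2) with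
    ((1 - kappa psiuu psivv u v - Gamma psiuu psiuv psivv u v)
     * (1 - kappa psiuu psivv u v + Gamma psiuu psiuv psivv u v)) by ring; trivial. }
rewrite HG; unfold kappa, detHessT; field.
Qed.

(** That [y] is non-caustic says exactly that the zeros of the gradient of [T_y] are
    nondegenerate. *)
Lemma images_opposite_sign psi psiu psiv psiuu psiuv psivv y1 y2 :
  smooth2 psi -> is_partial_u psi psiu -> is_partial_v psi psiv ->
  is_partial_u psiu psiuu -> is_partial_v psiu psiuv ->
  is_partial_u psiv psiuv -> is_partial_v psiv psivv ->
  isolated psi psiuu psiuv psivv y1 y2 ->
  ~ caustic psiu psiv psiuu psiuv psivv y1 y2 ->
  exists m1 m2, is_image psiu psiv y1 y2 m1 m2 /\
    kappa psiuu psivv m1 m2 < 1 /\ 0 < detHessT psiuu psiuv psivv m1 m2 /\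
    forall b1 b2, is_image psiu psiv y1 y2 b1 b2 -> (b1, b2) <> (m1, m2) ->
    exists c1 c2, is_image psiu psiv y1 y2 c1 c2 /\ (c1, c2) <> (m1, m2) /\
      detHessT psiuu psiuv psivv b1 b2 * detHessT psiuu psiuv psivv c1 c2 < 0.
Proof.
intros S0 Hu Hv Huu Huv Hvu Hvv [Hco [r Hr]] Hnc.
destruct (delay_gradient psi psiu psiv psiuu psiuv psivv y1 y2)
  as (F & Hgrad & Him & Hj & Ht); trivial.
destruct (gradient_zeros_opposite_sign (Tdelay psi y1 y2) F)
  as (m1 & m2 & Hm & Hmt & Hmj & H); trivial.
- exists r; intros u v Hfar; rewrite Ht, Hj.
  destruct (Hr u v Hfar); now apply hessian_pos_of_eigenvalues.
- intros u v H0; rewrite Hj; intros E; apply Hnc; exists u, v.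
  apply Him in H0; destruct H0; unfold eta1, eta2; repeat split; trivial; lra.
- rewrite Ht in Hmt; rewrite Hj in Hmj; apply Him in Hm.
  exists m1, m2; split; [trivial|split; [lra|split; [trivial|]]].
  intros b1 b2 Hb Hne; apply Him in Hb.
  destruct (H b1 b2 Hb Hne) as (c1 & c2 & Hc & Hcm & Hbc).
  rewrite !Hj in Hbc; apply Him in Hc; eauto.
Qed.

Theorem theorem2p3
  (psi psiu psiv psiuu psiuv psivv : fun2)
  (Hsmooth : smooth2 psi)
  (Hu : is_partial_u psi psiu) (Hv : is_partial_v psi psiv)
  (Huu : is_partial_u psiu psiuu) (Huv : is_partial_v psiu psiuv)
  (Hvu : is_partial_u psiv psiuv) (Hvv : is_partial_v psiv psivv)
  (Hiso : forall y1 y2, ~ caustic psiu psiv psiuu psiuv psivv y1 y2 ->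
            isolated psi psiuu psiuv psivv y1 y2) :
  ((forall y1 y2, ~ caustic psiu psiv psiuu psiuv psivv y1 y2 ->
      two_images psiu psiv y1 y2 ->
      three_images psiu psiv y1 y2 /\
      exists x1 x2, detHessT psiuu psiuv psivv x1 x2 < 0) /\
   (forall x1 x2, detHessT psiuu psiuv psivv x1 x2 < 0 ->
      ~ caustic psiu psiv psiuu psiuv psivv (eta1 psiu x1 x2) (eta2 psiv x1 x2) ->
      three_images psiu psiv (eta1 psiu x1 x2) (eta2 psiv x1 x2))) /\
  (forall x1 x2, 1 < kappa psiuu psivv x1 x2 ->
      ~ caustic psiu psiv psiuu psiuv psivv (eta1 psiu x1 x2) (eta2 psiv x1 x2) ->
      three_images psiu psiv (eta1 psiu x1 x2) (eta2 psiv x1 x2)).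
Proof.
assert (Himg : forall x1 x2, is_image psiu psiv (eta1 psiu x1 x2) (eta2 psiv x1 x2) x1 x2)
  by (intros; unfold is_image, eta1, eta2; lra).
(* Any image [b] other than the minimum [m] comes with an image [c] of opposite sign, so [m], [b],
   [c] are distinct and one of [b], [c] has negative determinant. The facts about [kappa] and
   [detHessT] at [m] serve to show that a given [x0] is not [m]. *)
assert (K : forall y1 y2, ~ caustic psiu psiv psiuu psiuv psivv y1 y2 ->
  exists m1 m2, kappa psiuu psivv m1 m2 < 1 /\ 0 < detHessT psiuu psiuv psivv m1 m2 /\
  forall b1 b2, is_image psiu psiv y1 y2 b1 b2 -> (b1, b2) <> (m1, m2) ->
    three_images psiu psiv y1 y2 /\ exists x1 x2, detHessT psiuu psiuv psivv x1 x2 < 0).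
{ intros y1 y2 Hnc.
  destruct (images_opposite_sign psi psiu psiv psiuu psiuv psivv y1 y2)
    as (m1 & m2 & Hm & Hk & Hd & H); auto.
  exists m1, m2; split; [trivial|split; [trivial|]]; intros b1 b2 Hb Hbm.
  destruct (H b1 b2 Hb Hbm) as (c1 & c2 & Hc & Hcm & Hbc); split.
  - exists m1, m2, b1, b2, c1, c2; repeat split; try apply Hm; try apply Hb; try apply Hc; auto.
    intros E; injection E; intros -> ->.
    pose proof (pow2_ge_0 (detHessT psiuu psiuv psivv c1 c2)); simpl in *; lra.
  - destruct (Rlt_dec (detHessT psiuu psiuv psivv b1 b2) 0); [now exists b1, b2|].
    exists c1, c2; nra. }
split; [split|].
- intros y1 y2 Hnc (a1 & a2 & b1 & b2 & Ha & Hb & Hab).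
  destruct (K y1 y2 Hnc) as (m1 & m2 & _ & _ & H).
  (* At least one of the two distinct images differs from [m]. *)
  destruct (classic ((a1, a2) = (m1, m2))) as [E|E].
  + apply (H b1 b2); trivial; congruence.
  + now apply (H a1 a2).
- intros x1 x2 Hx Hnc; destruct (K _ _ Hnc) as (m1 & m2 & _ & Hd & H).
  apply (H x1 x2); trivial; intros E; injection E; intros -> ->; lra.
- intros x1 x2 Hx Hnc; destruct (K _ _ Hnc) as (m1 & m2 & Hk & _ & H).
  apply (H x1 x2); trivial; intros E; injection E; intros -> ->; lra.
Qed.
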